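(* Let $K$ be a field, and let $m_0<m_1<m_2<m_3$ be positive integers with $\gcd=1$, $m_i=m_0+id$ ($d>0$), minimally generating the numerical semigroup they generate. Write $m_0=3a+b$ with integers $a\ge 1$, $b\in\{1,2,3\}$, and suppose $b\in\{1,2\}$. Let $E_b\subseteq R_b$ be the kernel of the $K$-algebra homomorphism $\varphi_b:R_b\to K[X_0,X_1,X_2,X_3][t]$ given by $X_i\mapsto X_i$, $\Phi(i,j)\mapsto\phi(i,j)t$, $\Psi(b,j)\mapsto\psi(b,j)t$ (its image is the Rees algebra $R[\wp t]$ of the defining ideal $\wp$ of the monomial curve $X_i=T^{m_i}$). Then, with respect to (the restriction to $R_b$ of) the monomial order $>_{\mathcal E}$, a Gröbner basis of $E_b$ is the set consisting of all $A(i;b,j)$ ($i\in\{1,2,3\}$, $j\in[0,2-b]$), all $B(i,j)$ ($i,j\in\{1,2\}$), $D$, $L(0)$, $L(1)$, and $Q(1,1),Q(1,2)$ if $b=1$, resp. $Q(2,1)$ if $b=2$.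
   Context: $[u,v]=\{n\in\mathbb{Z}:u\le n\le v\}$. $\phi(1,1)=X_1^2-X_2X_0$, $\phi(1,2)=\phi(2,1)=X_1X_2-X_3X_0$, $\phi(2,2)=X_2^2-X_1X_3$; $\psi(b,j)=X_{b+j}X_3^a-X_jX_0^{a+d}$ for $j\in[0,3-b]$. $R_b=K[X_1,X_2,X_3,X_0,\Psi(b,0),\dots,\Psi(b,3-b),\Phi(2,2),\Phi(1,2),\Phi(1,1)]$ is a polynomial ring in these indeterminates. Conventions: $\Phi(i,j)=\Phi(j,i)$; $\Phi(i,j)=0$ if $i$ or $j\notin\{1,2\}$; $\Psi(b,j)=0$ if $j\notin[0,3-b]$; $X_i=0$ if $i\notin[0,3]$; $\epsilon(u,v)=u+v$ if $u+v<3$, $=3$ if $u+v\ge3$. Monomial order $>_{\mathcal E}$ (on $R_b[t]$, restricted to $R_b$): a monomial is $t^kX_1^{\alpha_1}X_2^{\alpha_2}X_3^{\alpha_3}X_0^{\alpha_0}\prod_{i=0}^{3-b}\Psi(b,i)^{\beta_i}\Phi(2,2)^{\gamma_1}\Phi(1,2)^{\gamma_2}\Phi(1,1)^{\gamma_3}$, $\alpha=(\alpha_1,\alpha_2,\alpha_3,\alpha_0)$, $\beta=(\beta_0,\dots,\beta_{3-b})$, $\gamma=(\gamma_1,\gamma_2,\gamma_3)$. With the additive weight $\omega(X_i)=m_i$, $\omega(\Phi(i,j))=m_i+m_j$, $\omega(\Psi(b,j))=am_3+m_{b+j}$ on $t$-free monomials, one monomial is larger than another iff the first applicable condition holds: (i)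 larger $k$; (ii) equal $k$ and larger $\omega$ of the $t$-free part; (iii) larger $\sum\beta_i$; (iv) equal $\sum\beta_i$ and rightmost nonzero entry of $\beta-\beta'$ negative; (v) $\beta=\beta'$ and larger $\sum\gamma_i$; (vi) $\beta=\beta'$, equal $\sum\gamma_i$, rightmost nonzero entry of $\gamma-\gamma'$ negative; (vii) $\beta=\beta'$, $\gamma=\gamma'$, rightmost nonzero entry of $\alpha-\alpha'$ negative. Polynomials: $D=(X_1^2-X_2X_0)\Phi(1,2)-(X_1X_2-X_3X_0)\Phi(1,1)$; $B(i,j)=\phi(i,j)\Psi(b,3-b)-(X_3^{a+1}-X_{3-b}X_0^{a+d})\Phi(i,j)$; $L(i)=X_i\Phi(2,2)-X_{i+1}\Phi(1,2)+X_{i+2}\Phi(1,1)$, $i\in\{0,1\}$; $A(i;b,j)=X_i\Psi(b,j)-X_{b+i+j-\epsilon(i,b+j)}\Psi(b,\epsilon(i,b+j)-b)-X_3^a\Phi(i,b+j)+X_0^{a+d}[\Phi(i,j)-\Phi(b+i+j-3,3-b)]$; $Q(1,1)=\Psi(1,0)\Phi(2,2)+\Psi(1,2)\Phi(1,1)-\Psi(1,1)\Phi(1,2)$; $Q(1,2)=\Psi(1,1)^2-\Psi(1,2)\Psi(1,0)-X_3^{a-1}\Psi(1,2)\Phi(2,2)+X_0^{a+d-1}\Psi(1,0)\Phi(1,1)-X_3^{a-1}X_0^{a+d-1}(\Phi(1,2)^2-\Phi(2,2)\Phi(1,1))$; $Q(2,1)=\Psi(2,0)^2\Phi(2,2)-X_3^{a-1}\Psi(2,1)\Phi(2,2)^2-\Psi(2,1)\Psi(2,0)\Phi(1,2)-X_3^{a-1}X_0^{a+d-1}\Phi(1,2)^3+\Psi(2,1)^2\Phi(1,1)+X_3^{a-1}X_0^{a+d-1}\Phi(2,2)\Phi(1,2)\Phi(1,1)+X_0^{a+d-1}\Psi(2,0)\Phi(1,1)^2$.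 *)

(* Defs.v *)
From mathcomp Require Import all_boot all_algebra.
From mathcomp Require Import mpoly.
Unset Printing Implicit Defensive.
Import GRing.Theory.
Local Open Scope ring_scope.

Definition mi (m0 d i : nat) : nat := (m0 + i * d)%N.

Definition minimally_generating (m : 'I_4 -> nat) : Prop :=
  forall i : 'I_4, ~ (exists c : 'I_4 -> nat,
      c i = 0%N /\ m i = (\sum_(j < 4) c j * m j)%N).

(* The ring R_b = K[X1,X2,X3,X0,Psi(b,0..3-b),Phi(2,2),Phi(1,2),Phi(1,1)]. *)
(* Number of indeterminates: 4 + (4-b) + 3 = 11 - b  (b in {1,2}).         *)
(* Variable layout (0-based): 0:X1 1:X2 2:X3 3:X0, 4+j : Psi(b,j)           *)
(* (0<=j<=3-b), 8-b : Phi(2,2), 9-b : Phi(1,2), 10-b : Phi(1,1).            *)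
Definition nvars (b : nat) : nat := (10 - b).+1.

Section Ring.
Variables (K : fieldType) (b : nat).
Local Notation n := (nvars b).
Local Notation Rb := {mpoly K[n]}.

Definition var (k : nat) : Rb := 'X_(inord k).

Definition Xr (i : nat) : Rb :=
  match i with 1 => var 0 | 2 => var 1 | 3 => var 2 | 0 => var 3 | _ => 0 end.
Definition Psir (j : nat) : Rb := if (j <= 3 - b)%N then var (4 + j) else 0.
Definition Phir (i j : nat) : Rb :=
  match i, j with
  | 2, 2 => var (8 - b)
  | 1, 2 | 2, 1 => var (9 - b)
  | 1, 1 => var (10 - b)
  | _, _ => 0
  end.
End Ring.

Definition phiB (T : comNzRingType) (x : nat -> T) (i j : nat) : T :=
  match i, j with
  | 1, 1 => x 1%N ^+ 2 - x 2%N * x 0%N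
  | 1, 2 | 2, 1 => x 1%N * x 2%N - x 3%N * x 0%N
  | 2, 2 => x 2%N ^+ 2 - x 1%N * x 3%N
  | _, _ => 0
  end.
Definition psiB (T : comNzRingType) (x : nat -> T) (a d b j : nat) : T :=
  x (b + j)%N * x 3%N ^+ a - x j * x 0%N ^+ (a + d).

Arguments phiB {T}. Arguments psiB {T}.
(* The target ring K[X0,X1,X2,X3][t], realised as K[X0,X1,X2,X3,t]:        *)
(* variable i (0<=i<=3) is X_i, variable 4 is t.                           *)
Section Target.
Variable K : fieldType.
Definition Xt (i : nat) : {mpoly K[5]} := if (i <= 3)%N then 'X_(inord i) else 0.
Definition tt_ : {mpoly K[5]} := 'X_(inord 4).

Definition phib_img (a d b k : nat) : {mpoly K[5]} :=
  if (k < 4)%N then Xt (match k with 0 => 1 | 1 => 2 | 2 => 3 | _ => 0 end)%N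
  else if (k < 8 - b)%N then psiB Xt a d b (k - 4) * tt_
  else if k == (8 - b)%N then phiB Xt 2 2 * tt_
  else if k == (9 - b)%N then phiB Xt 1 2 * tt_
  else phiB Xt 1 1 * tt_.

Definition phib (a d b : nat) (p : {mpoly K[nvars b]}) : {mpoly K[5]} :=
  comp_mpoly [tuple phib_img a d b i | i < nvars b] p.

Definition Eb (a d b : nat) (p : {mpoly K[nvars b]}) : Prop := phib a d b p = 0.
End Target.

Definition mco (b : nat) (m : 'X_{1..nvars b}) (k : nat) : nat := m (inord k).

Definition wvar (m0 d a b k : nat) : nat :=
  if (k < 4)%N then mi m0 d (match k with 0 => 1 | 1 => 2 | 2 => 3 | _ => 0 end)%N
  else if (k < 8 - b)%N then (a * mi m0 d 3 + mi m0 d (b + (k - 4)))%N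
  else if k == (8 - b)%N then (mi m0 d 2 + mi m0 d 2)%N
  else if k == (9 - b)%N then (mi m0 d 1 + mi m0 d 2)%N
  else (mi m0 d 1 + mi m0 d 1)%N.

Definition omega (m0 d a b : nat) (m : 'X_{1..nvars b}) : nat :=
  (\sum_(k < nvars b) m k * wvar m0 d a b k)%N.

Arguments mco {b}.
Definition alphaE b (m : 'X_{1..nvars b}) : seq nat := [seq mco m k | k <- iota 0 4].
Definition betaE b (m : 'X_{1..nvars b}) : seq nat := [seq mco m k | k <- iota 4 (4 - b)].
Definition gammaE b (m : 'X_{1..nvars b}) : seq nat := [seq mco m k | k <- iota (8 - b) 3].

Arguments alphaE {b}. Arguments betaE {b}. Arguments gammaE {b}.
(* "the rightmost nonzero entry of u - v is negative" (false if u = v) *)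
Definition rightmost_neg (u v : seq nat) : bool :=
  foldl (fun acc p => if p.1 == p.2 then acc else (p.1 < p.2)%N) false (zip u v).

Definition mgtE (m0 d a b : nat) (m m' : 'X_{1..nvars b}) : bool :=
  let w := omega m0 d a b m in let w' := omega m0 d a b m' in
  let be := betaE m in let be' := betaE m' in
  let ga := gammaE m in let ga' := gammaE m' in
  [|| (w' < w)%N,
      (w == w') && (sumn be' < sumn be)%N,
      (w == w') && (sumn be == sumn be') && rightmost_neg be be',
      (w == w') && (be == be') && (sumn ga' < sumn ga)%N,
      (w == w') && (be == be') && (sumn ga == sumn ga') && rightmost_neg ga ga'
    | (w == w') && (be == be') && (ga == ga') && rightmost_neg (alphaE m) (alphaE m')].

Definition is_lead_mon (K : fieldType) (n : nat) (gt : rel 'X_{1..n})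
    (p : {mpoly K[n]}) (m : 'X_{1..n}) : Prop :=
  m \in msupp p /\ forall m', m' \in msupp p -> m' != m -> gt m m'.

Arguments is_lead_mon {K n}.
Definition mdivides (n : nat) (m m' : 'X_{1..n}) : Prop := forall i, (m i <= m' i)%N.

Arguments mdivides {n}.
Definition groebner_basis (K : fieldType) (n : nat) (gt : rel 'X_{1..n})
    (I : {mpoly K[n]} -> Prop) (G : seq {mpoly K[n]}) : Prop :=
  (forall g, g \in G -> I g) /\
  (forall f, I f -> f != 0 ->
     exists2 g, g \in G &
       exists mg mf, [/\ is_lead_mon gt g mg, is_lead_mon gt f mf & mdivides mg mf]).

Arguments groebner_basis {K n}.
Section Gens.
Variables (K : fieldType) (a d b : nat).
Local Notation X := (Xr K b).
Local Notation Psi := (Psir K b).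
Local Notation Phi := (Phir K b).

Definition epsE (u v : nat) : nat := if (u + v < 3)%N then (u + v)%N else 3%N.

Definition polD : {mpoly K[nvars b]} :=
  (X 1 ^+ 2 - X 2 * X 0) * Phi 1 2 - (X 1 * X 2 - X 3 * X 0) * Phi 1 1.
Definition polB (i j : nat) : {mpoly K[nvars b]} :=
  phiB X i j * Psi (3 - b) - (X 3 ^+ (a + 1) - X (3 - b) * X 0 ^+ (a + d)) * Phi i j.
Definition polL (i : nat) : {mpoly K[nvars b]} :=
  X i * Phi 2 2 - X i.+1 * Phi 1 2 + X i.+2 * Phi 1 1.
(* A(i;b,j).  Natural-number subtraction is exact here, except for
   b+i+j-3, which is only used as an index of Phi; when b+i+j<3 the
   truncated value 0 is outside {1,2}, so Phi(.,.) = 0 as required. *)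
Definition polA (i j : nat) : {mpoly K[nvars b]} :=
  X i * Psi j - X (b + i + j - epsE i (b + j)) * Psi (epsE i (b + j) - b)
  - X 3 ^+ a * Phi i (b + j) + X 0 ^+ (a + d) * (Phi i j - Phi (b + i + j - 3) (3 - b)).

Definition polQ11 : {mpoly K[nvars b]} :=
  Psi 0 * Phi 2 2 + Psi 2 * Phi 1 1 - Psi 1 * Phi 1 2.
Definition polQ12 : {mpoly K[nvars b]} :=
  Psi 1 ^+ 2 - Psi 2 * Psi 0 - X 3 ^+ (a - 1) * Psi 2 * Phi 2 2
  + X 0 ^+ (a + d - 1) * Psi 0 * Phi 1 1
  - X 3 ^+ (a - 1) * X 0 ^+ (a + d - 1) * (Phi 1 2 ^+ 2 - Phi 2 2 * Phi 1 1).
Definition polQ21 : {mpoly K[nvars b]} :=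
  Psi 0 ^+ 2 * Phi 2 2 - X 3 ^+ (a - 1) * Psi 1 * Phi 2 2 ^+ 2
  - Psi 1 * Psi 0 * Phi 1 2 - X 3 ^+ (a - 1) * X 0 ^+ (a + d - 1) * Phi 1 2 ^+ 3
  + Psi 1 ^+ 2 * Phi 1 1 + X 3 ^+ (a - 1) * X 0 ^+ (a + d - 1) * Phi 2 2 * Phi 1 2 * Phi 1 1
  + X 0 ^+ (a + d - 1) * Psi 0 * Phi 1 1 ^+ 2.

Definition GBb : seq {mpoly K[nvars b]} :=
  [seq polA i j | i <- [:: 1; 2; 3]%N, j <- iota 0 (3 - b)]
  ++ [seq polB i j | i <- [:: 1; 2]%N, j <- [:: 1; 2]%N]
  ++ [:: polD; polL 0; polL 1]
  ++ (if b == 1%N then [:: polQ11; polQ12] else [:: polQ21]).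
End Gens.

(* Main.v *)
(**
   No nonzero element of the kernel E_b is a combination of standard monomials
   (those divisible by no leading monomial of the listed generators): this suffices,
   because every element of E_b can be tail-reduced.  So let f be such a combination,
   homogeneous of degree D in t, and evaluate it at points of polynomial rings over K.
   In a vanishing sum the lexicographically lowest exponent is attained by two
   monomials of f, so it is enough that at suitable points the lowest exponents of
   standard monomials are distinct.

   If X_{i+2} = p X_{i+1} - q X_i, then phi(1,2) = p phi(1,1) and
   phi(2,2) = q phi(1,1).  Lowest order in phi(1,1) singles out the monomials with the
   most Psi's; on phi(1,1) = 0 the X_i form a geometric progression and the standard
   monomials containing a Psi get distinct exponents.  Hence no Psi occurs in f.  Then
   letting q tend to infinity excludes Phi(2,2), lowest order in phi(1,1) excludes
   Phi(1,2), and what remains is phi(1,1)^D times a polynomial in the X_i.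
*)
Require Import Defs.
From HB Require Import structures.
From mathcomp Require Import all_boot all_order all_algebra.
From mathcomp Require Import mpoly.
From mathcomp Require Import zify ring.
Set Implicit Arguments.
Unset Strict Implicit.
Unset Printing Implicit Defensive.
Import Order.TTheory GRing.Theory Num.Theory.
Local Open Scope ring_scope.

(** * The monomial order as a lexicographic order of additive functionals *)

Section LexOrder.
Variables (T : Type).
Implicit Types (fs : seq (T -> int)) (l : T -> int) (x y z : T).

Fixpoint lexg fs x y : bool :=
  if fs is l :: fs' then (l y < l x) || (l x == l y) && lexg fs' x y else false.

Lemma lexg_irr fs x : lexg fs x x = false.
Proof. by elim: fs => //= l fs ->; rewrite ltxx andbF. Qed.

Lemma lexg_trans fs y x z : lexg fs x y -> lexg fs y z -> lexg fs x z.
Proof.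
elim: fs => //= l fs IH /orP[h1|/andP[/eqP h1 h2]] /orP[h3|/andP[/eqP h3 h4]].
- by rewrite (lt_trans h3 h1).
- by rewrite -h3 h1.
- by rewrite h1 h3.
- by rewrite h1 h3 eqxx (IH h2 h4) orbT.
Qed.

Lemma lexg_total fs x y : ~~ lexg fs x y -> ~~ lexg fs y x ->
  [seq l x | l <- fs] = [seq l y | l <- fs].
Proof.
by elim: fs => //= l fs IH; case: ltgtP => //= -> h1 h2; rewrite IH.
Qed.

Lemma lexg_cat fs fs' x y : lexg (fs ++ fs') x y =
  lexg fs x y || ([seq l x | l <- fs] == [seq l y | l <- fs]) && lexg fs' x y.
Proof.
elim: fs => //= l fs ->; rewrite eqseq_cons.
by case: (ltgtP (l x) (l y)) => //= _; rewrite ?andbF.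
Qed.

End LexOrder.

(** Reversal brings the rightmost entry to the front, and negation makes the smaller entry count as
    the larger value. *)
Lemma lexg_rightmost_neg (T : Type) (fs : seq (T -> nat)) (x y : T) :
  rightmost_neg [seq l x | l <- fs] [seq l y | l <- fs]
  = lexg [seq (fun z => - (l z)%:Z) | l <- rev fs] x y.
Proof.
rewrite /rightmost_neg; elim/last_ind: fs => //= fs l IH.
rewrite rev_rcons !map_rcons zip_rcons ?size_map // foldl_rcons /= IH.
rewrite ltrN2 eqr_opp ltz_nat eqz_nat.
by case: ltngtP.
Qed.

Lemma rightmost_neg_irr (u : seq nat) : rightmost_neg u u = false.
Proof. by rewrite /rightmost_neg; elim: u => //= k u; rewrite eqxx. Qed.

Section EliminationOrder.
Variables (m0 d a b : nat).
Hypothesis b12 : (b == 1%N) || (b == 2%N).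
Hypothesis m0_gt0 : (0 < m0)%N.
Local Notation n := (nvars b).
Local Notation gt := (@mgtE m0 d a b).
Implicit Types m p q : 'X_{1..n}.

Definition mcoZ (k : nat) (m : 'X_{1..n}) : int := - (mco m k)%:Z.

(** One additive functional per criterion of the order, by precedence; the tie-breaks on [beta],
    [gamma], [alpha] become negated coordinates read from right to left. *)
Definition functionals : seq ('X_{1..n} -> int) :=
  [:: (fun m => (omega m0 d a b m)%:Z); (fun m => (sumn (betaE m))%:Z)]
  ++ [seq mcoZ k | k <- rev (iota 4 (4 - b))]
  ++ [:: (fun m => (sumn (gammaE m))%:Z)]
  ++ [seq mcoZ k | k <- rev (iota (8 - b) 3)] ++ [seq mcoZ k | k <- rev (iota 0 4)].

Lemma mgtE_lexg m p : gt m p = lexg functionals m p.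
Proof.
have rn s : rightmost_neg [seq mco m k | k <- s] [seq mco p k | k <- s]
    = lexg [seq mcoZ k | k <- rev s] m p.
  have := lexg_rightmost_neg [seq (fun q => mco q k) | k <- s] m p.
  by rewrite -!map_comp => ->; rewrite -map_rev -map_comp.
have eqs s : ([seq l m | l <- [seq mcoZ k | k <- rev s]]
   == [seq l p | l <- [seq mcoZ k | k <- rev s]])
   = ([seq mco m k | k <- s] == [seq mco p k | k <- s]).
  rewrite -!map_comp !map_rev (can_eq revK).
  elim: s => //= k s IH; rewrite !eqseq_cons -IH.
  by rewrite /mcoZ eqr_opp eqz_nat.
rewrite /functionals lexg_cat [lexg (_ ++ _) _ _]lexg_cat.
rewrite [lexg (_ ++ _) _ _]lexg_cat [lexg (_ ++ _) _ _]lexg_cat !eqs -!rn /mgtE.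
rewrite -/(betaE m) -/(betaE p) -/(gammaE m) -/(gammaE p) -/(alphaE m) -/(alphaE p).
cbv beta iota delta [lexg map].
move: (betaE m) (betaE p) (gammaE m) (gammaE p) (rightmost_neg (alphaE m) _) => be be' ga ga' r.
rewrite !eqseq_cons !ltz_nat !eqz_nat !eqxx !(andbF, andbT, orbF).
case: (ltngtP (omega m0 d a b m)) => //= _.
have [->|_] := eqVneq be be'; last by rewrite !(andbF, orbF).
rewrite !ltnn !eqxx rightmost_neg_irr /=.
have [->|_] := eqVneq ga ga'; last by rewrite !(andbF, orbF).
by rewrite !ltnn !eqxx rightmost_neg_irr.
Qed.

Lemma mcoD m p k : mco (m + p)%MM k = (mco m k + mco p k)%N.
Proof. by rewrite /mco mnmDE. Qed.

Lemma mco_inj m p : (forall k, (k < n)%N -> mco m k = mco p k) -> m = p.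
Proof. by move=> h; apply/mnmP=> i; have := h i (ltn_ord i); rewrite /mco inord_val. Qed.

Lemma sum_mco m (E : nat -> nat) :
  (\sum_(i < n) m i * E i = \sum_(0 <= k < n) mco m k * E k)%N.
Proof. by rewrite big_mkord; apply: eq_bigr => i _; rewrite /mco inord_val. Qed.

Lemma omegaD m p : omega m0 d a b (m + p)%MM = (omega m0 d a b m + omega m0 d a b p)%N.
Proof. by rewrite /omega -big_split; apply: eq_bigr => i _; rewrite mnmDE mulnDl. Qed.

Lemma sumn_mcoD m p s : sumn [seq mco (m + p)%MM k | k <- s]
  = (sumn [seq mco m k | k <- s] + sumn [seq mco p k | k <- s])%N.
Proof. by elim: s => //= k s ->; rewrite mcoD addnACA. Qed.

(** Every functional is additive, so its difference on two monomials does not change when both are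
    multiplied by a third. *)
Lemma mgtED m p q : gt (p + m)%MM (q + m)%MM = gt p q.
Proof.
rewrite !mgtE_lexg.
have : all (fun l => (l (p + m)%MM - l (q + m)%MM == l p - l q)) functionals.
  have allm s : all (fun l => l (p + m)%MM - l (q + m)%MM == l p - l q)
      [seq mcoZ k | k <- s].
    by elim: s => //= k s ->; rewrite andbT /mcoZ !mcoD; lia.
  rewrite /functionals !all_cat !allm /= /betaE /gammaE !omegaD !sumn_mcoD /=.
  rewrite !mcoD !andbT; do 2?[apply/andP; split]; lia.
elim: functionals => //= l fs IH /andP[/eqP e /IH ->].
by rewrite -subr_gt0 e subr_gt0 -subr_eq0 e subr_eq0.
Qed.

Lemma mgtE_irr m : gt m m = false.
Proof. by rewrite mgtE_lexg lexg_irr. Qed.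

Lemma mgtE_trans p m q : gt m p -> gt p q -> gt m q.
Proof. by rewrite !mgtE_lexg; apply: lexg_trans. Qed.

Lemma mgtE_total m p : m != p -> gt m p || gt p m.
Proof.
rewrite !mgtE_lexg; apply: contraR; rewrite negb_or => /andP[h1 h2].
have := lexg_total h1 h2; rewrite /functionals !map_cat.
have eqs s t t' : [seq l m | l <- [seq mcoZ k | k <- rev s]] ++ t
   = [seq l p | l <- [seq mcoZ k | k <- rev s]] ++ t' ->
   {in s, forall k, mco m k = mco p k} /\ t = t'.
  move/eqP; rewrite eqseq_cat ?size_map // -!map_comp => /andP[/eqP/eq_in_map e /eqP ->].
  split=> // k ks; have /= := e k; rewrite mem_rev => /(_ ks) /eqP.
  by rewrite /mcoZ eqr_opp eqz_nat => /eqP.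
move/eqP; rewrite eqseq_cat // => /andP[_ /eqP/eqs[e4]].
move/eqP; rewrite eqseq_cat // => /andP[_ /eqP/eqs[e8]].
rewrite -[X in X = _]cats0 -[X in _ = X]cats0 => /eqs[e0 _].
apply/eqP/mco_inj => k kn.
(* The blocks of [alpha], [beta] and [gamma] cover all variable indices, so equal functionals force
   equal monomials. *)
have : k \in iota 0 4 ++ iota 4 (4 - b) ++ iota (8 - b) 3.
  by rewrite !mem_cat !mem_iota; move: kn b12; rewrite /nvars; lia.
by rewrite !mem_cat => /or3P[/e0|/e4|/e8].
Qed.

Lemma mdeg_omega m : (mdeg m <= omega m0 d a b m)%N.
Proof.
rewrite mdegE /omega; apply: leq_sum => i _; rewrite -{1}[m i]muln1 leq_mul2l.
apply/orP; right; rewrite /wvar /mi.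
by do 4?[case: ifP => _]; rewrite !addn_gt0 m0_gt0 ?orbT.
Qed.

Lemma mgtE_omega m p : gt m p -> (omega m0 d a b p <= omega m0 d a b m)%N.
Proof.
rewrite mgtE_lexg /= ltz_nat eqz_nat => /orP[/ltnW //|/andP[/eqP -> _]] //.
Qed.

(* Below a given monomial there are only finitely many: [mdeg <= omega]. *)
Lemma mgtE_ind (P : 'X_{1..n} -> Prop) :
  (forall m, (forall p, gt m p -> P p) -> P m) -> forall m, P m.
Proof.
move=> Pind m.
pose W := (omega m0 d a b m).+1.
pose c (p : 'X_{1..n}) := #|[set x : 'X_{1..n < W} | gt p x]|.
(* Induction on [c p], the number of monomials of degree below [W] that are smaller than [p]:
   passing to a smaller [q] keeps the weight below [W] and removes at least [q] from the count. *)
suff H k p : (c p < k)%N -> (omega m0 d a b p < W)%N -> P p.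
  exact: (H (c m).+1).
elim: k p => // k IH p cp pW; apply: Pind => q pq.
have qW : (omega m0 d a b q < W)%N by apply: leq_ltn_trans pW; exact: mgtE_omega.
apply: IH => //; apply: leq_trans (_ : c p <= k)%N; last by rewrite -ltnS.
have mq : (mdeg q < W)%N by apply: leq_ltn_trans qW; exact: mdeg_omega.
apply: proper_card; apply/properP; split.
  by apply/subsetP => x; rewrite !inE; apply: mgtE_trans.
by exists (BMultinom mq); rewrite !inE //= mgtE_irr.
Qed.
End EliminationOrder.

(** * Reduction to standard monomials *)

Section StandardMonomials.
Variables (K : fieldType) (n : nat) (gt : rel 'X_{1..n}).
Hypothesis gt_irr : forall m, gt m m = false.
Hypothesis gt_trans : forall p m q, gt m p -> gt p q -> gt m q.
Hypothesis gt_total : forall m p, m != p -> gt m p || gt p m.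
Hypothesis gtD : forall m p q, gt (p + m)%MM (q + m)%MM = gt p q.
Hypothesis gt_ind : forall P : 'X_{1..n} -> Prop,
  (forall m, (forall p, gt m p -> P p) -> P m) -> forall m, P m.

Lemma lead_mon_exists (f : {mpoly K[n]}) : f != 0 -> exists m, is_lead_mon gt f m.
Proof.
rewrite -msupp_eq0.
suff H (s : seq 'X_{1..n}) : s != [::] ->
    exists m, m \in s /\ forall p, p \in s -> p != m -> gt m p by exact: H.
elim: s => // m s IH _; have [->|/IH[q [qs qm]]] := eqVneq s [::].
  by exists m; split=> [|p]; rewrite ?mem_head // inE => /eqP ->; rewrite eqxx.
have [->|neq] := eqVneq m q.
  exists q; split=> [|p]; first exact: mem_head.
  by rewrite inE => /orP[->//|]; apply: qm.
have [mq|mq] := boolP (gt m q).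
  exists m; split=> [|p]; first exact: mem_head.
  rewrite inE => /orP[/eqP->|ps _]; first by rewrite eqxx.
  by have [->//|pq] := eqVneq p q; apply: gt_trans mq (qm _ ps pq).
exists q; split=> [|p]; first by rewrite inE qs orbT.
rewrite inE => /orP[/eqP->|]; last exact: qm.
by move: (gt_total neq); rewrite (negPf mq).
Qed.

Variables (E : {mpoly K[n]} -> Prop).
Hypothesis E0 : E 0.
Hypothesis ED : forall f g, E f -> E g -> E (f + g).
Hypothesis EM : forall f g, E g -> E (f * g).

Definition divb (e m : 'X_{1..n}) := [forall i, (e i <= m i)%N].

Lemma divbP e m : reflect (mdivides e m) (divb e m).
Proof. exact: forallP. Qed.

Variable lms : seq 'X_{1..n}.
Hypothesis lms_lead : forall e, e \in lms -> exists g, E g /\ is_lead_mon gt g e.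

Definition standard m := ~~ has (divb^~ m) lms.

Let EZ c f : E f -> E (c *: f).
Proof. by rewrite -mul_mpolyC; apply: EM. Qed.

Let EB f g : E f -> E g -> E (f - g).
Proof. by move=> Ef Eg; apply: ED => //; rewrite -scaleN1r; apply: EZ. Qed.

(** Remainders of single monomials combine linearly; [m] is a common strict upper bound for them. *)
Let reduce_sum m (s : seq 'X_{1..n}) (c : 'X_{1..n} -> K) :
  (forall p, p \in s -> exists r, E ('X_[p] - r)
     /\ forall q, q \in msupp r -> standard q /\ gt m q) ->
  exists r, E (\sum_(p <- s) c p *: 'X_[p] - r)
     /\ forall q, q \in msupp r -> standard q /\ gt m q.
Proof.
elim: s => [|p s IH] H.
  by exists 0; rewrite big_nil subr0; split=> // q; rewrite msupp0.
have [|r [Er rs]] := IH; first by move=> q qs; apply: H; rewrite inE qs orbT.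
have [r' [Er' rs']] := H p (mem_head _ _).
exists (c p *: r' + r); split.
  rewrite big_cons opprD addrACA -scalerBr; apply: ED => //; exact: EZ.
move=> q /msuppD_le; rewrite mem_cat => /orP[/msuppZ_le|]; [exact: rs'|exact: rs].
Qed.

(** Division with remainder, by induction along the order: cancelling a nonstandard [m] against a
    multiple of an element of [E] leaves only smaller monomials, which already have remainders. *)
Lemma reduce m : exists r, E ('X_[m] - r)
  /\ forall q, q \in msupp r -> standard q /\ (q = m \/ gt m q).
Proof.
elim/gt_ind: m => m IH; have [ms|] := boolP (standard m).
  by exists 'X_[m]; rewrite subrr; split=> // q; rewrite msuppX inE => /eqP ->; split=> //; left.
rewrite negbK => /hasP[e elm /divbP em].
have [g [Eg [eg lead]]] := lms_lead elm.
pose h := (g@_e)^-1 *: (g * 'X_[(m - e)%MM]).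
have emm : (e + (m - e))%MM = m by apply/mnmP=> i; rewrite mnmDE mnmBE subnKC.
have gne0 : g@_e != 0 by rewrite -mcoeff_msupp.
have Eh : E h by apply: EZ; rewrite mulrC; apply: EM.
have hm : h@_m = 1.
  have : h@_(e + (m - e)) = 1 by rewrite mcoeffZ addmC mcoeffMX mulVf.
  by rewrite emm.
have tail q : q \in msupp ('X_[m] - h) -> gt m q.
  have [->|qm] := eqVneq q m; first by rewrite mcoeff_msupp mcoeffB mcoeffX eqxx hm subrr eqxx.
  move/msuppB_le; rewrite mem_cat msuppX inE (negPf qm) /= => /msuppZ_le.
  rewrite (perm_mem (msuppMX _ _)) => /mapP[q' q'g eq].
  rewrite eq addmC; have := gtD (m - e)%MM e q'; rewrite emm => ->; apply: lead => //.
  by apply: contraNneq qm => q'e; rewrite eq q'e addmC emm.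
have [|r [Er rs]] := @reduce_sum m (msupp ('X_[m] - h)) (fun p => ('X_[m] - h)@_p).
  move=> p /tail mp; have [r [Er rs]] := IH p mp.
  exists r; split=> // q /rs[qs qp]; split=> //.
  by case: qp => [->//|]; apply: gt_trans.
exists r; split; last by move=> q /rs[qs mq]; split=> //; right.
rewrite -mpolyE in Er.
have -> : 'X_[m] - r = ('X_[m] - h - r) + h by ring.
exact: ED.
Qed.

(* A counterexample to the Groebner property can be tail-reduced to a nonzero
   element of [E] all of whose monomials are standard. *)
Lemma groebner_of_independent (G : seq {mpoly K[n]}) :
  (forall g, g \in G -> E g) ->
  (forall e, e \in lms -> exists2 g, g \in G & is_lead_mon gt g e) ->
  (forall f, E f -> {in msupp f, forall m, standard m} -> f = 0) ->
  groebner_basis gt E G.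
Proof.
move=> GE Glms indep; split=> // f Ef f0.
have [m [mf lead]] := lead_mon_exists f0.
have [ms|] := boolP (standard m); last first.
  rewrite negbK => /hasP[e /Glms[g gG ge] /divbP em].
  by exists g => //; exists e, m.
(* The leading monomial [m] is standard here, so only the tail of [f] is reduced. The remainder
   stays below [m], hence the coefficient of [m] survives. *)
have [|r [Er rs]] := @reduce_sum m (rem m (msupp f)) (fun p => f@_p).
  move=> p; rewrite (mem_rem_uniq _ (msupp_uniq f)) => /andP[pm pf].
  have [r [Er rs]] := reduce p; exists r; split=> // q /rs[qs H]; split=> //.
  have mp : gt m p by apply: lead.
  by case: H => [->//|]; apply: gt_trans.
rewrite (rem_filter _ (msupp_uniq f)) big_filter in Er.
have eqf : f = f@_m *: 'X_[m] + \sum_(p <- msupp f | predC1 m p) f@_p *: 'X_[p].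
  by rewrite [LHS]mpolyE (bigD1_seq m) ?msupp_uniq.
set t := (X in E (X - r)) in Er eqf.
have Ef' : E (f@_m *: 'X_[m] + r).
  have -> : f@_m *: 'X_[m] + r = f - (t - r) by rewrite [X in X - _]eqf opprB [r - t]addrC addrA addrK.
  exact: EB.
have mm : m \notin msupp r by apply/negP => /rs[_]; rewrite gt_irr.
have : (f@_m *: 'X_[m] + r)@_m = 0.
  rewrite (indep _ Ef') ?mcoeff0 // => p /msuppD_le; rewrite mem_cat => /orP[/msuppZ_le/mem_msuppXP <-//|].
  by case/rs.
rewrite mcoeffD mcoeffZ mcoeffX eqxx mulr1 (memN_msupp_eq0 mm) addr0 => /eqP.
by rewrite mcoeff_eq0 mf.
Qed.
End StandardMonomials.

(** * Lowest exponents in iterated polynomial rings *)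

Section LowestExponent.
Variable K : fieldType.

(* [K[z_{k-1}]...[z_0]], the outermost variable being [z_0]. *)
Fixpoint tower (k : nat) : idomainType :=
  if k is k'.+1 then {poly (tower k')} : idomainType else K.

Fixpoint towerC (k : nat) (c : K) : tower k :=
  if k is k'.+1 then (towerC k' c)%:P else c.

(* [lowest F e]: for the lexicographic order with the exponent of [z_0] compared
   first, [e] (restricted to the indices below [k]) is the least exponent of [F]. *)
Fixpoint lowest (k : nat) : tower k -> (nat -> nat) -> Prop :=
  if k is k'.+1 then fun F e =>
    (forall j, (j < e 0)%N -> F`_j = 0) /\ lowest F`_(e 0%N) (fun i => e i.+1)
  else fun F _ => F != 0.

Lemma lowest_eq k (F : tower k) e e' :
  (forall i, (i < k)%N -> e i = e' i) -> lowest F e -> lowest F e'.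
Proof.
elim: k F e e' => // k IH F e e' ee' /= [z l].
by rewrite -(ee' 0%N) //; split=> //; apply: IH l => i ik; apply: ee'.
Qed.

Lemma lowest_ex k (F : tower k) : F != 0 -> exists e, lowest F e.
Proof.
elim: k F => [|k IH] F F0; first by exists (fun=> 0%N).
have ex : exists j, F`_j != 0 by exists (size F).-1; rewrite -lead_coefE lead_coef_eq0.
case: (ex_minnP ex) => j Fj minj; have [e le] := IH _ Fj.
exists (fun i => if i is i'.+1 then e i' else j); split=> //= i ij.
by apply: contraTeq ij => /minj; rewrite -leqNgt.
Qed.

Lemma lowest1 k : lowest (1 : tower k) (fun=> 0%N).
Proof. by elim: k => [|k IH] /=; rewrite ?oner_eq0 // coef1 eqxx. Qed.

Lemma lowestN k (F : tower k) e : lowest F e -> lowest (- F) e.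
Proof.
elim: k F e => [|k IH] F e /=; first by rewrite oppr_eq0.
by move=> [F0 Fe]; rewrite coefN; split=> [j /F0|]; [rewrite coefN => ->; rewrite oppr0 | exact: IH].
Qed.

(** Exponents behave like a valuation: at the sum of the two least exponents only the product of the
    two lowest coefficients contributes, and it is nonzero in a domain. *)
Lemma lowestM k (F G : tower k) e e' :
  lowest F e -> lowest G e' -> lowest (F * G) (fun i => e i + e' i)%N.
Proof.
elim: k F G e e' => [|k IH] F G e e' /=; first exact: mulf_neq0.
move=> [F0 Fe] [G0 Ge]; split=> [j lt_j|].
  rewrite coefM big1 // => i _.
  have [/F0->|le_i] := ltnP i (e 0%N); first by rewrite mul0r.
  by rewrite G0 ?mulr0 //; have := ltn_ord i; lia.
have lt_e : (e 0 < (e 0 + e' 0).+1)%N by lia.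
rewrite coefM (bigD1 (Ordinal lt_e)) //= addKn big1 ?addr0; first exact: IH.
move=> i /eqP ne; have [/F0->|le_i] := ltnP i (e 0%N); first by rewrite mul0r.
rewrite G0 ?mulr0 //; have := ltn_ord i.
have : (i : nat) <> e 0%N by move=> h; apply: ne; apply: val_inj.
lia.
Qed.

Lemma lowestX k (F : tower k) e r : lowest F e -> lowest (F ^+ r) (fun i => r * e i)%N.
Proof.
move=> le; elim: r => [|r IH]; first exact: lowest1.
by rewrite exprS; apply: lowest_eq (lowestM le IH) => i _; rewrite mulSn.
Qed.

Lemma lowest_prod k (I : Type) (s : seq I) (F : I -> tower k) e :
  (forall i, lowest (F i) (e i)) ->
  lowest (\prod_(i <- s) F i) (fun j => \sum_(i <- s) e i j)%N.
Proof.
move=> le; elim: s => [|i s IH].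
  by rewrite big_nil; apply: lowest_eq (lowest1 k) => j _; rewrite big_nil.
rewrite big_cons; apply: lowest_eq (lowestM (le i) IH) => j _.
by rewrite big_cons.
Qed.

Lemma lowest_shift k (G : {poly (tower k)}) r e : lowest G`_0 e ->
  @lowest k.+1 (G * 'X^r) (fun i => if i is i'.+1 then e i' else r).
Proof. by move=> le; split=> [j jr|]; rewrite coefMXn ?jr ?ltnn ?subnn. Qed.

(** The terms of lexicographically least exponent must cancel among themselves, so there are at
    least two of them. The last clause records that their exponent of [z_0] is minimal among all
    terms. *)
Lemma lowest_tie k (I : eqType) (s : seq I) (c : I -> K) (F : I -> tower k) e :
  uniq s -> s != [::] -> {in s, forall i, c i != 0} ->
  {in s, forall i, lowest (F i) (e i)} ->
  \sum_(i <- s) towerC k (c i) * F i = 0 ->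
  exists i j, [/\ i \in s, j \in s, i != j, (forall r, (r < k)%N -> e i r = e j r)
    & (0 < k)%N -> {in s, forall j', e i 0%N <= e j' 0%N}%N].
Proof.
elim: k s F e => [|k IH] s F e us s0 c0 Fe sum0.
  case: s us s0 c0 Fe sum0 => [|i [|j s]] //= us _ c0 Fe sum0.
    have ci : c i != 0 := c0 _ (mem_head _ _).
    have Fi : F i != 0 := Fe _ (mem_head _ _).
    by move/eqP: sum0; rewrite big_seq1 /= mulf_eq0 (negPf ci) (negPf Fi).
  exists i, j; split => //; rewrite ?inE ?eqxx ?orbT //.
  by move: us; rewrite inE negb_or => /andP[/andP[]].
have [i0 i0s] : exists i, i \in s by case: s s0 {us c0 Fe sum0} => // i ? _; exists i; rewrite mem_head.
have ex : exists r, has (fun i => e i 0%N == r) s.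
  by exists (e i0 0%N); apply/hasP; exists i0.
case: (ex_minnP ex) => r /hasP[i1 i1s /eqP ei1] minr.
have rmin i : i \in s -> (r <= e i 0)%N.
  by move=> si; apply: minr; apply/hasP; exists i.
(* Taking the coefficient of [z_0^r] keeps exactly the terms whose exponent of [z_0] is the minimum
   [r]; the induction hypothesis treats these in one variable fewer. *)
pose s' := [seq i <- s | e i 0%N == r].
have s's i : i \in s' -> i \in s by rewrite mem_filter => /andP[].
have := IH s' (fun i => (F i)`_r) (fun i j => e i j.+1).
case.
- exact: filter_uniq.
- apply/eqP => s'0; have : i1 \in s' by rewrite mem_filter /= ei1 eqxx.
  by rewrite s'0.
- by move=> i /s's; apply: c0.
- move=> i; rewrite mem_filter => /andP[/eqP <- /Fe[]] //.
- have := congr1 (fun p : {poly _} => p`_r) sum0; rewrite coef_sum coef0; apply: etrans.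
  rewrite /s' big_filter big_mkcond /=. apply: eq_big_seq => i si.
  rewrite coefCM; case: ifP => // /negP/negP ne.
  have [F0 _] := Fe i si; rewrite F0 ?mulr0 //.
  by rewrite ltn_neqAle eq_sym ne rmin.
move=> i [j [si sj ij eij _]]; exists i, j; split; rewrite ?s's //.
  case=> [_|q]; last exact: eij.
  by move: si sj; rewrite !mem_filter => /andP[/eqP -> _] /andP[/eqP -> _].
move=> _ j' /rmin; move: si; rewrite mem_filter => /andP[/eqP -> _] //.
Qed.

Lemma towerC_zmod k : zmod_morphism (towerC k).
Proof. by elim: k => [|k IH] x y //=; rewrite IH rmorphB. Qed.
Lemma towerC_monoid k : monoid_morphism (towerC k).
Proof.
elim: k => [|k [IH1 IHM]]; split=> //= [|x y]; first by rewrite IH1.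
by rewrite IHM rmorphM.
Qed.
HB.instance Definition _ k := GRing.isZmodMorphism.Build K (tower k) (towerC k) (@towerC_zmod k).
HB.instance Definition _ k := GRing.isMonoidMorphism.Build K (tower k) (towerC k) (@towerC_monoid k).
End LowestExponent.

(** * Specializations of the Rees algebra *)

Lemma phiB_morph (A B : comNzRingType) (h : {rmorphism A -> B}) (x : nat -> A) (y : nat -> B) i j :
  (forall k, (k <= 3)%N -> h (x k) = y k) -> h (phiB x i j) = phiB y i j.
Proof.
move=> hx; case: i => [|[|[|i]]]; case: j => [|[|[|j]]]; rewrite /= ?rmorph0 //;
  by rewrite rmorphB ?rmorphXn ?rmorphM ?hx.
Qed.

Lemma psiB_morph (A B : comNzRingType) (h : {rmorphism A -> B}) (x : nat -> A) (y : nat -> B) a d b j :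
  (forall k, (k <= 3)%N -> h (x k) = y k) -> (b + j <= 3)%N ->
  h (psiB x a d b j) = psiB y a d b j.
Proof. by move=> hx bj; rewrite /psiB rmorphB !rmorphM !rmorphXn !hx //; lia. Qed.

Section Evaluation.
Variables (K : fieldType) (a d b : nat).
Hypothesis b12 : (b == 1%N) || (b == 2%N).
Local Notation n := (nvars b).

(** Images of the indeterminates at the point [x] with [t] set to 1; [tdeg] counts the power of [t]
    separately. *)
Definition value (A : comNzRingType) (x : nat -> A) (k : nat) : A :=
  if (k < 4)%N then x (match k with 0 => 1 | 1 => 2 | 2 => 3 | _ => 0 end)%N
  else if (k < 8 - b)%N then psiB x a d b (k - 4)
  else if k == (8 - b)%N then phiB x 2 2
  else if k == (9 - b)%N then phiB x 1 2
  else phiB x 1 1.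

Definition tdeg (m : 'X_{1..n}) : nat := \sum_(i < n) m i * (4 <= i)%N.

(** Sending X_i to [x i] and [t] to a polynomial variable turns membership in the kernel into a
    vanishing polynomial; the sum is its coefficient of t^D. *)
Lemma Eb_eval (A : comNzRingType) (iota : {rmorphism K -> A}) (x : nat -> A)
    (f : {mpoly K[n]}) (D : nat) : Eb K a d b f ->
  \sum_(m <- [seq m <- msupp f | tdeg m == D])
     iota f@_m * \prod_(i < n) value x i ^+ m i = 0.
Proof.
move=> Ef.
pose x5 (i : 'I_5) : {poly A} := if (i < 4)%N then (x i)%:P else 'X.
pose ev : {rmorphism {mpoly K[5]} -> {poly A}} := mmap (polyC \o iota) x5.
have evX k : (k <= 3)%N -> ev (Xt K k) = (x k)%:P.
  move=> k3; rewrite /Xt k3 /ev /= mmapX mmap1U /x5 inordK; last by lia.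
  by rewrite ltnS k3.
have evt : ev (tt_ K) = 'X by rewrite /tt_ /ev /= mmapX mmap1U /x5 inordK.
have evC (c : K) p : ev (c *: p) = (iota c)%:P * ev p.
  by rewrite -mul_mpolyC rmorphM /= mmapC.
have evimg (i : 'I_n) : ev (phib_img K a d b i) = (value x i)%:P * 'X ^+ (4 <= i)%N.
  rewrite /phib_img /value; have := ltn_ord i; rewrite /nvars.
  case: (ltnP i 4) => [i4 _|i4 lt_i].
    by rewrite expr0 mulr1 evX //; case: (i : nat) => [|[|[|?]]].
  have px k : (k <= 3)%N -> polyC (x k) = (fun k => (x k)%:P) k by [].
  case: ifP => [ib|_].
    rewrite rmorphM evt expr1 (psiB_morph _ _ evX); last by lia.
    by rewrite (psiB_morph _ _ px) //; lia.
  by do 2?[case: ifP => _]; rewrite rmorphM evt expr1 (phiB_morph _ _ evX) (phiB_morph _ _ px).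
have evp (i : 'I_n) k : ev (tnth [tuple phib_img K a d b i | i < n] i ^+ k)
    = (value x i ^+ k)%:P * 'X ^+ (k * (4 <= i)%N).
  by rewrite tnth_mktuple rmorphXn evimg exprMn -rmorphXn -exprM mulnC.
have := congr1 ev Ef; rewrite /phib comp_mpolyE rmorph0 rmorph_sum => /(congr1 (fun p : {poly A} => p`_D)).
rewrite coef0 coef_sum => H; apply: etrans H.
rewrite big_filter big_mkcond /=; apply: eq_bigr => m _.
rewrite evC rmorph_prod coefCM.
rewrite (eq_bigr _ (fun i _ => evp i (m i))).
rewrite big_split /= prodrXr -rmorph_prod coefCM coefXn.
by rewrite eq_sym; case: eqP; rewrite ?mulr1 ?mulr0.
Qed.
End Evaluation.

(** * Points in iterated polynomial rings and lowest exponents of monomials there *)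

Section Points.
Variables (K : fieldType) (a d b : nat).
Hypothesis b12 : (b == 1%N) || (b == 2%N).
Local Notation n := (nvars b).
Local Notation val := (value a d b).

(** Once the power of the outermost variable is split off, the remaining exponents are those of the
    cofactor at zero. *)
Lemma lowest_factor k (F G : {poly (tower K k)}) r s : F = G * 'X^r ->
  lowest G.[0] (nth 0%N s) -> @lowest K k.+1 F (nth 0%N (r :: s)).
Proof.
move=> -> le; have := @lowest_shift K k G r (nth 0%N s).
rewrite -horner_coef0 => /(_ le); apply: lowest_eq; by case.
Qed.

Lemma lowest_at0 k (F : {poly (tower K k)}) s :
  lowest F.[0] (nth 0%N s) -> @lowest K k.+1 F (nth 0%N (0%N :: s)).
Proof. by apply: lowest_factor; rewrite mulr1. Qed.

Lemma lowest_var k : lowest ('X : tower K k.+1) (nth 0 [:: 1])%N.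
Proof.
split=> [[|j] _ //|]; rewrite coefX //=.
apply: lowest_eq (lowest1 K k) => i _; by rewrite nth_nil.
Qed.

Definition weight (row : nat -> seq nat) (v : nat -> nat) (r : nat) : nat :=
  \sum_(0 <= k < n) v k * nth 0%N (row k) r.

(** [lowest_tie] for monomials evaluated at a point. The disjunction puts no condition on the value
    of a variable that does not occur, so that value may be zero. *)
Lemma point_tie (S : seq 'X_{1..n}) (c : 'X_{1..n} -> K) (x : nat -> tower K 4)
    (row : nat -> seq nat) :
  uniq S -> S != [::] -> {in S, forall m, c m != 0} ->
  \sum_(m <- S) towerC 4 (c m) * \prod_(i < n) val x i ^+ m i = 0 ->
  {in S, forall m k, (k < n)%N -> mco m k = 0%N \/ lowest (val x k) (nth 0%N (row k))} ->
  exists m p, [/\ m \in S, p \in S, m != p, (forall r, (r < 4)%N -> weight row (mco m) r = weight row (mco p) r)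
    & {in S, forall q, weight row (mco m) 0 <= weight row (mco q) 0}%N].
Proof.
move=> uS S0 c0 sum0 low.
have [|m [p [mS pS mp eq /(_ isT) min]]] :=
  @lowest_tie K 4 _ S c (fun m => \prod_(i < n) val x i ^+ m i) (fun m => weight row (mco m)) uS S0 c0 _ sum0.
  move=> m mS; have lowX (i : 'I_n) :
      lowest (val x i ^+ m i) (fun r => m i * nth 0 (row i) r)%N.
    have := low m mS i (ltn_ord i); rewrite /mco inord_val => -[->|/lowestX]//.
    by apply: lowest_eq (lowest1 _ _) => r _; rewrite mul0n.
  apply: lowest_eq (lowest_prod (index_enum 'I_n) lowX) => r _.
  by rewrite /weight -sum_mco.
by exists m, p; split.
Qed.

(* [rX], [rPsi], [rPhi] list the lowest exponents of the values of X_1, X_2, X_3, X_0,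
   of the Psi(b,j), and of Phi(2,2), Phi(1,2), Phi(1,1). *)
Definition rows (rX rPsi rPhi : nat -> seq nat) (k : nat) : seq nat :=
  if (k < 4)%N then rX k else if (k < 8 - b)%N then rPsi (k - 4)%N else rPhi (k - (8 - b))%N.

End Points.

(* The general solution of X_{i+2} = p X_{i+1} - q X_i with characteristic roots
   1/w and p - 1/w, so q = (pw - 1)/w^2; along it phi(1,2) = p phi(1,1) and
   phi(2,2) = q phi(1,1).  At 'X = 0, where phi(1,1) vanishes to order one, it
   degenerates to the geometric progression x w^(3-i). *)
Definition ptA (R : comNzRingType) (w x p : R) (i : nat) : {poly R} :=
  match i with
  | 0 => x%:P * w%:P ^+ 3
  | 1 => w%:P ^+ 2 * (x%:P + 'X)
  | 2 => x%:P * w%:P + p%:P * w%:P ^+ 2 * 'X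
  | 3 => x%:P + (1 - p%:P * w%:P + p%:P ^+ 2 * w%:P ^+ 2) * 'X
  | _ => 0
  end.

Section PointA.
Variables (R : comNzRingType) (w x p : R).
Local Notation pt := (ptA w x p).

Lemma ptA_at0 i : (i <= 3)%N -> (pt i).[0] = x * w ^+ (3 - i).
Proof.
by case: i => [|[|[|[|//]]]] _; rewrite /ptA !hornerE /= ?expr0; ring.
Qed.

(** The factor shared by the three values of phi besides one ['X]; at ['X = 0] it is 2x - pxw. *)
Definition ptA_norm : {poly R} := (2%:R * x - p * x * w)%:P + 'X.

Lemma ptA_phi11 : phiB pt 1 1 = (w ^+ 4)%:P * ptA_norm * 'X^1.
Proof. by rewrite /phiB /ptA /ptA_norm; ring. Qed.

Lemma ptA_phi12 : phiB pt 1 2 = (p * w ^+ 4)%:P * ptA_norm * 'X^1.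
Proof. by rewrite /phiB /ptA /ptA_norm; ring. Qed.

Lemma ptA_phi22 : phiB pt 2 2 = ((p * w - 1) * w ^+ 2)%:P * ptA_norm * 'X^1.
Proof. by rewrite /phiB /ptA /ptA_norm; ring. Qed.
End PointA.

Lemma ptA_psi (R : comNzRingType) (w x p : R) a d b j : (b + j <= 3)%N ->
  (psiB (ptA w x p) a d b j).[0] =
  (x ^+ a.+1 - x * w ^+ b * (x * w ^+ 3) ^+ (a + d)) * w ^+ (3 - (b + j)).
Proof.
move=> bj; transitivity (psiB (fun i => x * w ^+ (3 - i)) a d b j).
  exact: (@psiB_morph _ _ (horner_eval (0 : R)) _ _ _ _ _ _ (ptA_at0 w x p) bj).
rewrite /psiB subnn subn0 expr0 mulr1.
have -> : (3 - j = b + (3 - (b + j)))%N by lia.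
rewrite exprD [x ^+ a.+1]exprS; move: (w ^+ (3 - (b + j))) (w ^+ b) (x ^+ a) (_ ^+ (a + d)) => u v t s; ring.
Qed.

(** Columns are the exponents of ['X], [w], [x], [p]. Only the Phi(i,j) have positive order in ['X],
    each of order one. *)
Definition rowsA (a b e0 e1 e2 : nat) : nat -> seq nat := rows b
    (nth [::] [:: [:: 0; 2; 1; 0]; [:: 0; 1; 1; 0]; [:: 0; 0; 1; 0]; [:: 0; 3; 1; 0]])%N
    (fun j => [:: 0; 3 - (b + j); a.+1; 0])%N
    (nth [::] [:: [:: 1; e0 + 2; e1; e2];
                  [:: 1; e0 + 4; e1; e2 + 1];
                  [:: 1; e0 + 4; e1; e2]])%N.

Section LowestA.
Variables (K : fieldType) (a d b : nat).
Hypothesis b12 : (b == 1%N) || (b == 2%N).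
Local Notation n := (nvars b).
Local Notation w := ('X : tower K 3).
Local Notation x := (('X : tower K 2)%:P : tower K 3).
Local Notation p := (('X : tower K 1)%:P%:P : tower K 3).
Local Notation pt := (@ptA (tower K 3) w x p : nat -> tower K 4).

(* [e0], [e1], [e2] come from the lowest exponent of 2x - pxw, which depends on
   whether the characteristic is 2. *)
Lemma lowest_ptA : exists e0 e1 e2, forall k, (k < n)%N ->
  lowest (value a d b pt k) (nth 0%N (rowsA a b e0 e1 e2 k)).
Proof.
have lw : lowest w (nth 0 [:: 1])%N := lowest_var K 2.
have lx : lowest x (nth 0 [:: 0; 1])%N.
  by apply: lowest_at0; rewrite hornerC; apply: (lowest_var K 1).
have lp : lowest p (nth 0 [:: 0; 0; 1])%N.
  by do 2![apply: lowest_at0; rewrite hornerC]; apply: (lowest_var K 0).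
have lX i : (i <= 3)%N -> lowest (pt i) (nth 0 [:: 0; 3 - i; 1; 0])%N.
  move=> i3; apply: lowest_at0; rewrite ptA_at0 //.
  apply: lowest_eq (lowestM lx (lowestX (3 - i) lw)).
  by case=> [|[|[|r]]] //= _; rewrite ?muln1 ?muln0.
have lPsi j : (b + j <= 3)%N -> lowest (psiB pt a d b j) (nth 0 [:: 0; 3 - (b + j); a.+1; 0])%N.
  move=> bj; apply: lowest_at0; rewrite ptA_psi //.
  apply: lowest_factor (erefl _) _.
  (* As [b] is positive, the term with X_0^(a+d) vanishes at [w = 0] and x^(a+1) remains. *)
  have b0 : (0 : tower K 2) ^+ b = 0 by rewrite expr0n; move: b12; case: (b).
  rewrite !hornerE b0 mulr0 mul0r subr0.
  apply: lowest_eq (lowestX a.+1 (lowest_var K 1)).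
  by case=> [|[|r]] //= _; rewrite ?muln1 ?muln0.
have [e le] : exists e, lowest (ptA_norm w x p).[0] e.
  (* The coefficient of [w] is -px, nonzero in every characteristic. *)
  apply: lowest_ex; rewrite /ptA_norm !hornerE; apply/eqP => /(congr1 (fun q : {poly _} => q`_1)).
  rewrite coefB coefMX coef0 mulr_natl coefMn coefC mul0rn sub0r -rmorphM coefC /=.
  by apply/eqP; rewrite oppr_eq0 mulf_neq0 ?polyC_eq0 ?polyX_eq0.
have lM : lowest (ptA_norm w x p).[0] (nth 0 [:: e 0; e 1; e 2])%N.
  by apply: lowest_eq le; case=> [|[|[|]]].
exists (e 0%N), (e 1%N), (e 2%N) => k kn; rewrite /value /rowsA /rows.
case: ifP => [k4|k4].
  by case: k k4 {kn} => [|[|[|[|//]]]] _; apply: lX.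
case: ifP => [kb|kb]; first by apply: lPsi; lia.
have phi c s : lowest c (nth 0 s)%N ->
   lowest (c%:P * ptA_norm w x p * 'X^1 : tower K 4)
     (nth 0 [:: 1; nth 0 s 0 + e 0; nth 0 s 1 + e 1; nth 0 s 2 + e 2])%N.
  move=> lc; apply: lowest_factor (erefl _) _; rewrite hornerM hornerC.
  by apply: lowest_eq (lowestM lc lM); case=> [|[|[|]]].
case: ifP => [/eqP ->|k8].
  rewrite subnn ptA_phi22; apply: lowest_eq (phi _ [:: 2]%N _).
    by case=> [|[|[|[|]]]] //= _; rewrite addnC.
  have l1 : lowest (p * w - 1) (fun=> 0%N).
    apply: lowest_eq (_ : lowest (p * w - 1) (nth 0 [:: 0])%N); first by case=> [|[|[|]]].
    apply: lowest_at0; rewrite !hornerE.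
    by apply: lowest_eq (lowestN (lowest1 K 2)); case=> [|[|]].
  by apply: lowest_eq (lowestM l1 (lowestX 2 lw)); case=> [|[|[|]]].
case: ifP => [/eqP ->|k9].
  rewrite ptA_phi12 (_ : 9 - b - (8 - b) = 1)%N; last by lia.
  apply: lowest_eq (phi _ [:: 4; 0; 1]%N _).
    by case=> [|[|[|[|]]]] //= _; rewrite addnC.
  by apply: lowest_eq (lowestM lp (lowestX 4 lw)); case=> [|[|[|]]].
rewrite ptA_phi11 (_ : k - (8 - b) = 2)%N; last by move: kn k4 kb k8 k9; rewrite /nvars; lia.
apply: lowest_eq (phi _ [:: 4]%N _).
  by case=> [|[|[|[|]]]] //= _; rewrite addnC.
by apply: lowest_eq (lowestX 4 lw); case=> [|[|[|]]].
Qed.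
End LowestA.

(* The same recurrence solved backwards from X_2 = y, X_3 = z, with 'X = 1/q. *)
Definition ptB (R : comNzRingType) (y z p : R) (i : nat) : {poly R} :=
  match i with
  | 0 => ('X * (y%:P * p%:P ^+ 2 - z%:P * p%:P) - y%:P) * 'X^1
  | 1 => (y * p - z)%:P * 'X^1
  | 2 => y%:P
  | 3 => z%:P
  | _ => 0
  end.

(* Here phi(1,1) = - s 'X vanishes at 'X = 0. *)
Definition ptC (R : comNzRingType) (s y z : R) (i : nat) : {poly R} :=
  match i with
  | 0 => s%:P
  | 1 => (s * y)%:P
  | 2 => (s * y ^+ 2)%:P + 'X
  | 3 => z%:P
  | _ => 0
  end.

(** A generic point with X_0 as the outermost variable; phi(1,1) becomes X_1^2 at ['X = 0]. *)
Definition ptD (R : comNzRingType) (x1 x2 x3 : R) (i : nat) : {poly R} :=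
  match i with 0 => 'X | 1 => x1%:P | 2 => x2%:P | 3 => x3%:P | _ => 0 end.

Section PhiValues.
Variable R : comNzRingType.
Implicit Types x y z p s : R.

(** The value of phi(2,2). The values of phi(1,1) and phi(1,2) carry a further factor ['X], that is
    1/q, and so are negligible against it as q tends to infinity. *)
Definition ptB_norm y z p : {poly R} := 'X * (z ^+ 2 - p * y * z)%:P + (y ^+ 2)%:P.

Lemma ptB_phi11 y z p : phiB (ptB y z p) 1 1 = ptB_norm y z p * 'X^1.
Proof. by rewrite /phiB /ptB /ptB_norm; ring. Qed.

Lemma ptB_phi12 y z p : phiB (ptB y z p) 1 2 = p%:P * ptB_norm y z p * 'X^1.
Proof. by rewrite /phiB /ptB /ptB_norm; ring. Qed.

Lemma ptB_phi22 y z p : phiB (ptB y z p) 2 2 = ptB_norm y z p.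
Proof. by rewrite /phiB /ptB /ptB_norm; ring. Qed.

Lemma ptB_norm_at0 y z p : (ptB_norm y z p).[0] = y ^+ 2.
Proof. by rewrite /ptB_norm hornerD hornerM hornerX mul0r add0r hornerC. Qed.

Lemma ptB_x0_at0 y z p : ('X * (y%:P * p%:P ^+ 2 - z%:P * p%:P) - y%:P).[0] = - y.
Proof. by rewrite hornerD hornerM hornerX mul0r add0r hornerN hornerC. Qed.

Lemma ptC_phi11 s y z : phiB (ptC s y z) 1 1 = - s%:P * 'X^1.
Proof. by rewrite /phiB /ptC; ring. Qed.

Lemma ptC_phi12_at0 s y z : (phiB (ptC s y z) 1 2).[0] = s * (s * y ^+ 3 - z).
Proof. by rewrite /phiB /ptC !(hornerD, hornerN, hornerM, hornerC, hornerX); ring. Qed.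

Lemma ptD_phi11_at0 x1 x2 x3 : (phiB (ptD x1 x2 x3) 1 1).[0] = x1 ^+ 2.
Proof. by rewrite /phiB /ptD !(hornerD, hornerN, hornerM, horner_exp, hornerC, hornerX); ring. Qed.
End PhiValues.

Section LowestBCD.
Variables (K : fieldType) (a d b : nat).
Hypothesis b12 : (b == 1%N) || (b == 2%N).
Local Notation n := (nvars b).
Local Notation z1 := ('X : tower K 3).
Local Notation z2 := (('X : tower K 2)%:P : tower K 3).
Local Notation z3 := (('X : tower K 1)%:P%:P : tower K 3).

Let l1 : lowest z1 (nth 0 [:: 1])%N := lowest_var K 2.
Let l2 : lowest z2 (nth 0 [:: 0; 1])%N.
Proof. by apply: lowest_at0; rewrite hornerC; apply: (lowest_var K 1). Qed.
Let l3 : lowest z3 (nth 0 [:: 0; 0; 1])%N.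
Proof. by do 2![apply: lowest_at0; rewrite hornerC]; apply: (lowest_var K 0). Qed.

(** In this table and the next two, empty rows are placeholders for variables already excluded when
    the point is used: the Psi(b,j), then also Phi(2,2), then also Phi(1,2). *)
Definition rowsB : nat -> seq nat := rows b
  (nth [::] [:: [:: 1; 0; 1; 0]; [:: 0; 1; 0; 0]; [:: 0; 0; 1; 0]; [:: 1; 1; 0; 0]])%N
  (fun=> [::])
  (nth [::] [:: [:: 0; 2; 0; 0]; [:: 1; 2; 0; 1]; [:: 1; 2; 0; 0]])%N.

Definition rowsC : nat -> seq nat := rows b
  (nth [::] [:: [:: 0; 1; 1; 0]; [:: 0; 1; 2; 0]; [:: 0; 0; 0; 1]; [:: 0; 1; 0; 0]])%N
  (fun=> [::])
  (nth [::] [:: [::]; [:: 0; 1; 0; 1]; [:: 1; 1; 0; 0]])%N.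

Definition rowsD : nat -> seq nat := rows b
  (nth [::] [:: [:: 0; 1; 0; 0]; [:: 0; 0; 1; 0]; [:: 0; 0; 0; 1]; [:: 1; 0; 0; 0]])%N
  (fun=> [::])
  (nth [::] [:: [::]; [::]; [:: 0; 2; 0; 0]])%N.

Lemma lowest_ptB k : (k < n)%N -> (k < 4)%N || (8 - b <= k)%N ->
  lowest (value a d b (@ptB (tower K 3) z1 z2 z3 : nat -> tower K 4) k) (nth 0%N (rowsB k)).
Proof.
move=> kn; rewrite /value /rowsB /rows; case: ifP => [k4 _|k4 k8'].
  case: k k4 {kn} => [|[|[|[|//]]]] _.
  - apply: (lowest_factor (erefl _)); rewrite hornerC.
    apply: lowest_at0; rewrite !hornerE.
    by apply: lowest_eq (lowestN (lowest_var K 1)); case=> [|[|]].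
  - apply: lowest_at0; rewrite hornerC.
    by apply: lowest_eq l1; case=> [|[|[|]]].
  - apply: lowest_at0; rewrite hornerC.
    by apply: lowest_eq l2; case=> [|[|[|]]].
  - apply: (lowest_factor (erefl _)); rewrite ptB_x0_at0.
    by apply: lowest_eq (lowestN l1); case=> [|[|[|]]].
have -> : (k < 8 - b)%N = false by lia.
have lN : lowest (ptB_norm z1 z2 z3).[0] (nth 0 [:: 2])%N.
  rewrite ptB_norm_at0.
  by apply: lowest_eq (lowestX 2 l1); case=> [|[|[|]]].
case: ifP => [/eqP ->|k8].
  rewrite subnn ptB_phi22; apply: lowest_at0.
  by apply: lowest_eq lN; case=> [|[|[|]]].
case: ifP => [/eqP ->|k9].
  rewrite ptB_phi12 (_ : 9 - b - (8 - b) = 1)%N; last by lia.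
  apply: (lowest_factor (erefl _)); rewrite hornerM hornerC.
  by apply: lowest_eq (lowestM l3 lN); case=> [|[|[|]]].
rewrite ptB_phi11 (_ : k - (8 - b) = 2)%N; last by move: kn k4 k8 k9; rewrite /nvars; lia.
apply: (lowest_factor (erefl _)).
by apply: lowest_eq lN; case=> [|[|[|]]].
Qed.

Lemma lowest_ptC k : (k < n)%N -> (k < 4)%N || (9 - b <= k)%N ->
  lowest (value a d b (@ptC (tower K 3) z1 z2 z3 : nat -> tower K 4) k) (nth 0%N (rowsC k)).
Proof.
move=> kn; rewrite /value /rowsC /rows; case: ifP => [k4 _|k4 k9].
  case: k k4 {kn} => [|[|[|[|//]]]] _; apply: lowest_at0; rewrite ?hornerD !hornerC ?hornerX ?addr0.
  - by apply: lowest_eq (lowestM l1 l2); case=> [|[|[|]]].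
  - by apply: lowest_eq (lowestM l1 (lowestX 2 l2)); case=> [|[|[|]]].
  - by apply: lowest_eq l3; case=> [|[|[|]]].
  - by apply: lowest_eq l1; case=> [|[|[|]]].
have -> : (k < 8 - b)%N = false by lia.
have -> : (k == 8 - b)%N = false by lia.
case: ifP => [/eqP ->|k9'].
  rewrite (_ : 9 - b - (8 - b) = 1)%N; last by lia.
  apply: lowest_at0; rewrite ptC_phi12_at0.
  have lz : lowest (z1 * z2 ^+ 3 - z3) (nth 0 [:: 0; 0; 1])%N.
    apply: lowest_at0; rewrite !hornerE.
    apply: lowest_eq (lowestN (_ : lowest _ (nth 0 [:: 0; 1])%N)); first by case=> [|[|]].
    by apply: lowest_at0; rewrite hornerC; apply: (lowest_var K 0).
  by apply: lowest_eq (lowestM l1 lz); case=> [|[|[|]]].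
rewrite ptC_phi11 (_ : k - (8 - b) = 2)%N; last by move: kn k4 k9 k9'; rewrite /nvars; lia.
apply: (lowest_factor (erefl _)); rewrite hornerN hornerC.
by apply: lowest_eq (lowestN l1); case=> [|[|[|]]].
Qed.

Lemma lowest_ptD k : (k < n)%N -> (k < 4)%N || (10 - b <= k)%N ->
  lowest (value a d b (@ptD (tower K 3) z1 z2 z3 : nat -> tower K 4) k) (nth 0%N (rowsD k)).
Proof.
move=> kn; rewrite /value /rowsD /rows; case: ifP => [k4 _|k4 k9].
  case: k k4 {kn} => [|[|[|[|//]]]] _; last first.
  - by apply: lowest_eq (lowest_var K 3); case=> [|[|[|[|]]]].
  - apply: lowest_at0; rewrite hornerC.
    by apply: lowest_eq l3; case=> [|[|[|]]].
  - apply: lowest_at0; rewrite hornerC.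
    by apply: lowest_eq l2; case=> [|[|[|]]].
  - apply: lowest_at0; rewrite hornerC.
    by apply: lowest_eq l1; case=> [|[|[|]]].
have -> : (k < 8 - b)%N = false by lia.
have -> : (k == 8 - b)%N = false by lia.
have -> : (k == 9 - b)%N = false by lia.
rewrite (_ : k - (8 - b) = 2)%N; last by move: kn k4 k9; rewrite /nvars; lia.
apply: lowest_at0; rewrite ptD_phi11_at0.
by apply: lowest_eq (lowestX 2 l1); case=> [|[|[|]]].
Qed.
End LowestBCD.

(** * Standard exponents *)

(* Exponents of the leading monomials, in the variable layout of [nvars]; trailing
   zeros are omitted. *)
Definition leads (b : nat) : seq (seq nat) :=
  (if b == 1 then
    [:: [:: 1; 0; 0; 0; 1]; [:: 0; 1; 0; 0; 1]; [:: 0; 0; 1; 0; 1];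
        [:: 1; 0; 0; 0; 0; 1]; [:: 0; 1; 0; 0; 0; 1]; [:: 0; 0; 1; 0; 0; 1];
        [:: 2; 0; 0; 0; 0; 0; 1]; [:: 1; 1; 0; 0; 0; 0; 1]; [:: 0; 2; 0; 0; 0; 0; 1];
        [:: 2; 0; 0; 0; 0; 0; 0; 0; 1];
        [:: 0; 0; 0; 1; 0; 0; 0; 1]; [:: 1; 0; 0; 0; 0; 0; 0; 1];
        [:: 0; 0; 0; 0; 1; 0; 0; 1]; [:: 0; 0; 0; 0; 0; 2]]
  else
    [:: [:: 1; 0; 0; 0; 1]; [:: 0; 1; 0; 0; 1]; [:: 0; 0; 1; 0; 1];
        [:: 2; 0; 0; 0; 0; 1]; [:: 1; 1; 0; 0; 0; 1]; [:: 0; 2; 0; 0; 0; 1];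
        [:: 2; 0; 0; 0; 0; 0; 0; 1];
        [:: 0; 0; 0; 1; 0; 0; 1]; [:: 1; 0; 0; 0; 0; 0; 1];
        [:: 0; 0; 0; 0; 2; 0; 1]])%N.

Definition std (b : nat) (v : nat -> nat) : bool :=
  all (fun s => ~~ all (fun k => nth 0 s k <= v k)%N (iota 0 (nvars b))) (leads b).

Definition psideg (b : nat) (v : nat -> nat) : nat := \sum_(4 <= k < 8 - b) v k.
Definition phideg (b : nat) (v : nat -> nat) : nat := \sum_(8 - b <= k < nvars b) v k.
Section StandardExponents.
Implicit Types v : nat -> nat.

(** The cases follow the first Psi(1,j) present. With Psi(1,0) or Psi(1,1), the A(i;1,j) exclude
    X_1, X_2, X_3; Q(1,1) forbids Phi(2,2) beside Psi(1,0), and Q(1,2) allows Psi(1,1) only once.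
    With Psi(1,2) alone, the B(i,j) leave at most one of X_1, X_2, and L(0), L(1) restrict
    Phi(2,2). *)
Lemma std1_psi v : std 1 v -> (0 < psideg 1 v)%N ->
  ((0 < v 4 /\ v 5 <= 1 /\ v 0 = 0 /\ v 1 = 0 /\ v 2 = 0 /\ v 7 = 0) \/
   (v 4 = 0 /\ v 5 = 1 /\ v 0 = 0 /\ v 1 = 0 /\ v 2 = 0 /\ (v 7 = 0 \/ v 3 = 0)) \/
   (v 4 = 0 /\ v 5 = 0 /\ 0 < v 6 /\ v 0 + v 1 <= 1 /\ v 7 = 0) \/
   (v 4 = 0 /\ v 5 = 0 /\ 0 < v 6 /\ v 3 = 0 /\ v 0 = 0 /\ v 1 <= 1))%N.
Proof.
rewrite /std /psideg /index_iota /= !big_cons big_nil.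
move: (v 0%N) (v 1%N) (v 2%N) (v 3%N) (v 4%N) (v 5%N) (v 6%N) (v 7%N) (v 8%N) (v 9%N).
move=> v0 v1 v2 v3 v4 v5 v6 v7 v8 v9 /=.
case: v4 => [|v4] //=; case: v5 => [|[|v5]] //=; case: v0 => [|[|v0]] //=;
case: v1 => [|[|v1]] //=; case: v2 => [|v2] //=; case: v7 => [|v7] //=; case: v3 => [|v3] //=;
case: v6 => [|v6] //=.
all: lia.
Qed.

(** Here Q(2,1) forbids Psi(2,0)^2 Phi(2,2), which separates exponent one of Psi(2,0) from higher
    exponents. *)
Lemma std2_psi v : std 2 v -> (0 < psideg 2 v)%N ->
  ((1 < v 4 /\ v 0 = 0 /\ v 1 = 0 /\ v 2 = 0 /\ v 6 = 0) \/
   (v 4 = 1 /\ v 0 = 0 /\ v 1 = 0 /\ v 2 = 0 /\ (v 6 = 0 \/ v 3 = 0)) \/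
   (v 4 = 0 /\ 0 < v 5 /\ v 0 + v 1 <= 1 /\ v 6 = 0) \/
   (v 4 = 0 /\ 0 < v 5 /\ v 3 = 0 /\ v 0 = 0 /\ v 1 <= 1))%N.
Proof.
rewrite /std /psideg /index_iota /= !big_cons big_nil.
move: (v 0%N) (v 1%N) (v 2%N) (v 3%N) (v 4%N) (v 5%N) (v 6%N) (v 7%N) (v 8%N).
move=> v0 v1 v2 v3 v4 v5 v6 v7 v8 /=.
case: v4 => [|[|v4]] //=; case: v5 => [|v5] //=; case: v0 => [|[|v0]] //=;
case: v1 => [|[|v1]] //=; case: v2 => [|v2] //=; case: v6 => [|v6] //=; case: v3 => [|v3] //=.
all: lia.
Qed.

Lemma psideg1 v : psideg 1 v = (v 4 + v 5 + v 6)%N.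
Proof. by rewrite /psideg /index_iota /= !big_cons big_nil; lia. Qed.
Lemma psideg2 v : psideg 2 v = (v 4 + v 5)%N.
Proof. by rewrite /psideg /index_iota /= !big_cons big_nil; lia. Qed.
Lemma phideg1 v : phideg 1 v = (v 7 + v 8 + v 9)%N.
Proof.
by rewrite /phideg (_ : 8 - 1 = 7)%N // /index_iota /= !big_cons big_nil; lia.
Qed.
Lemma phideg2 v : phideg 2 v = (v 6 + v 7 + v 8)%N.
Proof.
by rewrite /phideg (_ : 8 - 2 = 6)%N // /index_iota /= !big_cons big_nil; lia.
Qed.

Lemma weight1 row v r : weight 1 row v r =
  (v 0 * nth 0 (row 0) r + v 1 * nth 0 (row 1) r + v 2 * nth 0 (row 2) r + v 3 * nth 0 (row 3) r
   + v 4 * nth 0 (row 4) r + v 5 * nth 0 (row 5) r + v 6 * nth 0 (row 6) r + v 7 * nth 0 (row 7) r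
   + v 8 * nth 0 (row 8) r + v 9 * nth 0 (row 9) r)%N.
Proof. by rewrite /weight /index_iota /= !big_cons big_nil addn0 !addnA. Qed.
Lemma weight2 row v r : weight 2 row v r =
  (v 0 * nth 0 (row 0) r + v 1 * nth 0 (row 1) r + v 2 * nth 0 (row 2) r + v 3 * nth 0 (row 3) r
   + v 4 * nth 0 (row 4) r + v 5 * nth 0 (row 5) r + v 6 * nth 0 (row 6) r + v 7 * nth 0 (row 7) r
   + v 8 * nth 0 (row 8) r)%N.
Proof. by rewrite /weight /index_iota /= !big_cons big_nil addn0 !addnA. Qed.

Lemma eq_upto9 v v' : (v 0 = v' 0 /\ v 1 = v' 1 /\ v 2 = v' 2 /\ v 3 = v' 3 /\ v 4 = v' 4
    /\ v 5 = v' 5 /\ v 6 = v' 6 /\ v 7 = v' 7 /\ v 8 = v' 8)%N ->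
  forall k, (k < nvars 2)%N -> v k = v' k.
Proof. by move=> [? [? [? [? [? [? [? [? ?]]]]]]]]; do 9?[case => //]. Qed.
Lemma eq_upto10 v v' : (v 0 = v' 0 /\ v 1 = v' 1 /\ v 2 = v' 2 /\ v 3 = v' 3 /\ v 4 = v' 4
    /\ v 5 = v' 5 /\ v 6 = v' 6 /\ v 7 = v' 7 /\ v 8 = v' 8 /\ v 9 = v' 9)%N ->
  forall k, (k < nvars 1)%N -> v k = v' k.
Proof. by move=> [? [? [? [? [? [? [? [? [? ?]]]]]]]]]; do 10?[case => //]. Qed.

Lemma rowsA_phideg b a e0 e1 e2 v : (b == 1)%N || (b == 2)%N ->
  weight b (rowsA a b e0 e1 e2) v 0 = phideg b v.
Proof.
by case/orP => /eqP ->; rewrite ?(phideg1, phideg2) ?(weight1, weight2) /rowsA /rows /=; lia.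
Qed.

(** Column 0 and the total degree fix the degrees in Phi and Psi. The other columns give three
    equations, which have a unique solution within the families of standard exponents. *)
Lemma rowsA_inj b a e0 e1 e2 v v' : (b == 1)%N || (b == 2)%N ->
  std b v -> std b v' -> (0 < psideg b v)%N ->
  (psideg b v + phideg b v = psideg b v' + phideg b v')%N ->
  (forall r, (r < 4)%N -> weight b (rowsA a b e0 e1 e2) v r = weight b (rowsA a b e0 e1 e2) v' r) ->
  forall k, (k < nvars b)%N -> v k = v' k.
Proof.
move=> b12 sv sv' v_gt0 eqD eqw.
have eqphi : phideg b v = phideg b v'.
  by rewrite -!(rowsA_phideg a e0 e1 e2) // eqw.
have eqpsi : psideg b v = psideg b v' by lia.
have v'_gt0 : (0 < psideg b v')%N by rewrite -eqpsi.
(* The weights contain these nonlinear products, whose equality [lia] cannot derive itself. *)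
have [h0 h1 h2 ha] : [/\ e0 * phideg b v = e0 * phideg b v', e1 * phideg b v = e1 * phideg b v',
  e2 * phideg b v = e2 * phideg b v' & a * psideg b v = a * psideg b v']%N by rewrite eqphi eqpsi.
move: eqphi eqpsi h0 h1 h2 ha (eqw 1%N isT) (eqw 2%N isT) (eqw 3%N isT).
case/orP: b12 => /eqP b_eq; move: sv sv' v_gt0 v'_gt0 {eqD eqw}; rewrite {b}b_eq.
- move=> sv sv' v_gt0 v'_gt0; move: (std1_psi sv v_gt0) (std1_psi sv' v'_gt0) => {sv sv' v_gt0 v'_gt0}.
  rewrite !(phideg1, psideg1, weight1) /rowsA /rows /= => H H' E1 E2 E3 E4 E5 E6 W1 W2 W3.
  apply: eq_upto10; move: H H' E1 E2 E3 E4 E5 E6 W1 W2 W3.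
  move: (v 0%N) (v 1%N) (v 2%N) (v 3%N) (v 4%N) (v 5%N) (v 6%N) (v 7%N) (v 8%N) (v 9%N).
  move=> v0 v1 v2 v3 v4 v5 v6 v7 v8 v9.
  move: (v' 0%N) (v' 1%N) (v' 2%N) (v' 3%N) (v' 4%N) (v' 5%N) (v' 6%N) (v' 7%N) (v' 8%N) (v' 9%N).
  move=> u0 u1 u2 u3 u4 u5 u6 u7 u8 u9 H H' E1 E2 E3 E4 E5 E6 W1 W2 W3.
  (* Equal Phi-degrees cancel except that Phi(2,2) counts 2 in place of 4; this deficit is moved to
     the opposite side. *)
  have {W1} W1 : (3 * v3 + 2 * v0 + v1 + 2 * v4 + v5 + 2 * u7
      = 3 * u3 + 2 * u0 + u1 + 2 * u4 + u5 + 2 * v7)%N by clear - E1 E3 W1; lia.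
  have {W2} W2 : (v0 + v1 + v2 + v3 = u0 + u1 + u2 + u3)%N by clear - E1 E2 E4 E6 W2; lia.
  have {W3} W3 : v8 = u8 by clear - E1 E5 W3; lia.
  clear E3 E4 E5 E6.
  case: H => [H|[H|[H|H]]]; case: H' => [H'|[H'|[H'|H']]]; lia.
- move=> sv sv' v_gt0 v'_gt0; move: (std2_psi sv v_gt0) (std2_psi sv' v'_gt0) => {sv sv' v_gt0 v'_gt0}.
  rewrite !(phideg2, psideg2, weight2) /rowsA /rows /= => H H' E1 E2 E3 E4 E5 E6 W1 W2 W3.
  apply: eq_upto9; move: H H' E1 E2 E3 E4 E5 E6 W1 W2 W3.
  move: (v 0%N) (v 1%N) (v 2%N) (v 3%N) (v 4%N) (v 5%N) (v 6%N) (v 7%N) (v 8%N).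
  move=> v0 v1 v2 v3 v4 v5 v6 v7 v8.
  move: (v' 0%N) (v' 1%N) (v' 2%N) (v' 3%N) (v' 4%N) (v' 5%N) (v' 6%N) (v' 7%N) (v' 8%N).
  move=> u0 u1 u2 u3 u4 u5 u6 u7 u8 H H' E1 E2 E3 E4 E5 E6 W1 W2 W3.
  have {W1} W1 : (3 * v3 + 2 * v0 + v1 + v4 + 2 * u6
      = 3 * u3 + 2 * u0 + u1 + u4 + 2 * v6)%N by clear - E1 E3 W1; lia.
  have {W2} W2 : (v0 + v1 + v2 + v3 = u0 + u1 + u2 + u3)%N by clear - E1 E2 E4 E6 W2; lia.
  have {W3} W3 : v7 = u7 by clear - E1 E5 W3; lia.
  clear E3 E4 E5 E6.
  case: H => [H|[H|[H|H]]]; case: H' => [H'|[H'|[H'|H']]]; lia.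
Qed.

Lemma std1_phi v : std 1 v ->
  ((v 7 = 0 \/ v 0 = 0 /\ v 3 = 0) /\ (v 8 = 0 \/ v 0 <= 1))%N.
Proof.
rewrite /std /=; move: (v 0%N) (v 1%N) (v 2%N) (v 3%N) (v 4%N) (v 5%N) (v 6%N) (v 7%N) (v 8%N) (v 9%N).
move=> v0 v1 v2 v3 v4 v5 v6 v7 v8 v9 /=.
case: v7 => [|v7] //=; case: v8 => [|v8] //=; case: v0 => [|[|v0]] //=; case: v3 => [|v3] //=;
 rewrite ?andbF //; lia.
Qed.

Lemma std2_phi v : std 2 v ->
  ((v 6 = 0 \/ v 0 = 0 /\ v 3 = 0) /\ (v 7 = 0 \/ v 0 <= 1))%N.
Proof.
rewrite /std /=; move: (v 0%N) (v 1%N) (v 2%N) (v 3%N) (v 4%N) (v 5%N) (v 6%N) (v 7%N) (v 8%N).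
move=> v0 v1 v2 v3 v4 v5 v6 v7 v8 /=.
case: v6 => [|v6] //=; case: v7 => [|v7] //=; case: v0 => [|[|v0]] //=; case: v3 => [|v3] //=;
 rewrite ?andbF //; lia.
Qed.

(** The order in ['X] counts X_1, X_0, Phi(1,2) and Phi(1,1). Since L(0) and L(1) forbid X_0 and X_1
    beside Phi(2,2), it drops below the Phi-degree exactly when Phi(2,2) occurs. *)
Lemma rowsB_phi22 b v : (b == 1)%N || (b == 2)%N -> std b v -> psideg b v = 0%N ->
  (weight b (rowsB b) v 0 < phideg b v)%N = (0 < v (8 - b))%N.
Proof.
case/orP => /eqP -> sv.
  rewrite psideg1 weight1 phideg1 /rowsB /rows /= => p0.
  by have [] := std1_phi sv; rewrite (_ : 8 - 1 = 7)%N //; lia.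
rewrite psideg2 weight2 phideg2 /rowsB /rows /= => p0.
by have [] := std2_phi sv; rewrite (_ : 8 - 2 = 6)%N //; lia.
Qed.

Lemma rowsB_inj b v v' : (b == 1)%N || (b == 2)%N ->
  std b v -> std b v' -> psideg b v = 0%N -> psideg b v' = 0%N ->
  phideg b v = phideg b v' -> (0 < v (8 - b))%N ->
  (forall r, (r < 4)%N -> weight b (rowsB b) v r = weight b (rowsB b) v' r) ->
  forall k, (k < nvars b)%N -> v k = v' k.
Proof.
move=> b12 sv sv' p0 p0' eqD g0 eqw.
have g0' : (0 < v' (8 - b))%N by rewrite -rowsB_phi22 // -eqw // -eqD rowsB_phi22.
move: (eqw 0%N isT) (eqw 1%N isT) (eqw 2%N isT) (eqw 3%N isT) p0 p0' eqD g0 g0' => {eqw}.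
case/orP: b12 => /eqP b_eq; move: sv sv'; rewrite {b}b_eq.
  rewrite !(psideg1, phideg1, weight1) /rowsB /rows (_ : 8 - 1 = 7)%N //=.
  move=> /std1_phi[h _] /std1_phi[h' _] W0 W1 W2 W3 p0 p0' eqD g0 g0'.
  by apply: eq_upto10; lia.
rewrite !(psideg2, phideg2, weight2) /rowsB /rows (_ : 8 - 2 = 6)%N //=.
move=> /std2_phi[h _] /std2_phi[h' _] W0 W1 W2 W3 p0 p0' eqD g0 g0'.
by apply: eq_upto9; lia.
Qed.

(** X_1^2 and X_0 X_2 have equal rows, but D forbids X_1^2 beside Phi(1,2). So the exponent of X_1
    is at most one, and the parity of the exponent of y determines it. *)
Lemma rowsC_inj b v v' : (b == 1)%N || (b == 2)%N ->
  std b v -> std b v' -> psideg b v = 0%N -> psideg b v' = 0%N ->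
  v (8 - b)%N = 0%N -> v' (8 - b)%N = 0%N ->
  phideg b v = phideg b v' -> (0 < v (9 - b))%N ->
  (forall r, (r < 4)%N -> weight b (rowsC b) v r = weight b (rowsC b) v' r) ->
  forall k, (k < nvars b)%N -> v k = v' k.
Proof.
move=> b12 sv sv' p0 p0' q0 q0' eqD g0 eqw.
move: (eqw 0%N isT) (eqw 1%N isT) (eqw 2%N isT) (eqw 3%N isT) p0 p0' q0 q0' eqD g0 => {eqw}.
case/orP: b12 => /eqP b_eq; move: sv sv'; rewrite {b}b_eq.
  rewrite !(psideg1, phideg1, weight1) /rowsC /rows (_ : 8 - 1 = 7)%N // (_ : 9 - 1 = 8)%N //=.
  move=> /std1_phi[_ h] /std1_phi[_ h'] W0 W1 W2 W3 p0 p0' q0 q0' eqD g0.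
  by apply: eq_upto10; lia.
rewrite !(psideg2, phideg2, weight2) /rowsC /rows (_ : 8 - 2 = 6)%N // (_ : 9 - 2 = 7)%N //=.
move=> /std2_phi[_ h] /std2_phi[_ h'] W0 W1 W2 W3 p0 p0' q0 q0' eqD g0.
by apply: eq_upto9; lia.
Qed.

(** The order in ['X] is the exponent of Phi(1,1), so at a fixed Phi-degree the least order belongs
    to the most factors Phi(1,2). *)
Lemma rowsC_phi12 b v : (b == 1)%N || (b == 2)%N -> v (8 - b)%N = 0%N ->
  (weight b (rowsC b) v 0 + v (9 - b) = phideg b v)%N.
Proof.
case/orP => /eqP ->.
  by rewrite phideg1 weight1 /rowsC /rows (_ : 8 - 1 = 7)%N // (_ : 9 - 1 = 8)%N //=; lia.
by rewrite phideg2 weight2 /rowsC /rows (_ : 8 - 2 = 6)%N // (_ : 9 - 2 = 7)%N //=; lia.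
Qed.

Lemma rowsD_inj b v v' : (b == 1)%N || (b == 2)%N ->
  psideg b v = 0%N -> psideg b v' = 0%N ->
  v (8 - b)%N = 0%N -> v' (8 - b)%N = 0%N -> v (9 - b)%N = 0%N -> v' (9 - b)%N = 0%N ->
  phideg b v = phideg b v' ->
  (forall r, (r < 4)%N -> weight b (rowsD b) v r = weight b (rowsD b) v' r) ->
  forall k, (k < nvars b)%N -> v k = v' k.
Proof.
move=> b12 p0 p0' q0 q0' r0 r0' eqD eqw.
move: (eqw 0%N isT) (eqw 1%N isT) (eqw 2%N isT) (eqw 3%N isT) p0 p0' q0 q0' r0 r0' eqD => {eqw}.
case/orP: b12 => /eqP ->.
  rewrite !(psideg1, phideg1, weight1) /rowsD /rows (_ : 8 - 1 = 7)%N // (_ : 9 - 1 = 8)%N //=.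
  by move=> *; apply: eq_upto10; lia.
rewrite !(psideg2, phideg2, weight2) /rowsD /rows (_ : 8 - 2 = 6)%N // (_ : 9 - 2 = 7)%N //=.
by move=> *; apply: eq_upto9; lia.
Qed.
End StandardExponents.

(** * Independence of standard monomials modulo the kernel *)

Section Independence.
Variables (K : fieldType) (a d b : nat).
Hypothesis b12 : (b == 1%N) || (b == 2%N).
Local Notation n := (nvars b).
Local Notation z1 := ('X : tower K 3).
Local Notation z2 := (('X : tower K 2)%:P : tower K 3).
Local Notation z3 := (('X : tower K 1)%:P%:P : tower K 3).

Lemma tdegE (m : 'X_{1..n}) : tdeg m = (psideg b (mco m) + phideg b (mco m))%N.
Proof.
rewrite /tdeg (sum_mco m (fun k => 4 <= k)%N) /psideg /phideg.
have b8 : (8 - b <= n)%N by rewrite /nvars; lia.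
have b4 : (4 <= 8 - b)%N by lia.
rewrite (@big_cat_nat _ _ _ 4) //=; last exact: leq_trans b4 b8.
rewrite big_nat_cond big1 ?add0n => [|k /andP[/andP[_ k4] _]]; last by rewrite leqNgt k4 muln0.
rewrite (@big_cat_nat _ _ _ (8 - b)) //=.
congr (_ + _)%N; rewrite big_nat_cond [RHS]big_nat_cond; apply: eq_bigr => k /andP[/andP[h _] _].
  by rewrite h muln1.
by rewrite (leq_trans b4 h) muln1.
Qed.

Lemma mco_psi0 (m : 'X_{1..n}) k : psideg b (mco m) = 0%N -> (4 <= k < 8 - b)%N -> mco m k = 0%N.
Proof.
move=> + kb; rewrite /psideg (big_rem k) ?mem_index_iota //= => /eqP.
by rewrite addn_eq0 => /andP[/eqP].
Qed.

Lemma standard_independent (f : {mpoly K[n]}) :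
  Eb K a d b f -> {in msupp f, forall m, std b (mco m)} -> f = 0.
Proof.
move=> Ef fstd; apply/eqP; rewrite -msupp_eq0; apply/negPn/negP => f0.
have [m0 m0f] : exists m, m \in msupp f.
  by case: (msupp f) f0 => // m s _; exists m; rewrite mem_head.
(* The coefficient of t^D sees only the monomials of t-degree [D], so one nonempty homogeneous part
   suffices for the contradiction. *)
pose D := tdeg m0; pose S := [seq m <- msupp f | tdeg m == D].
have Sstd m : m \in S -> std b (mco m) by rewrite mem_filter => /andP[_ /fstd].
have SD m : m \in S -> (psideg b (mco m) + phideg b (mco m))%N = D.
  by rewrite mem_filter -tdegE => /andP[/eqP].
have uS : uniq S by rewrite filter_uniq ?msupp_uniq.
have S0 : S != [::].
  by apply/eqP => S0; have : m0 \in S; [rewrite mem_filter eqxx | rewrite S0].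
have c0 : {in S, forall m, f@_m != 0}.
  by move=> m; rewrite mem_filter -mcoeff_msupp => /andP[].
have sum0 (x : nat -> tower K 4) :
    \sum_(m <- S) towerC 4 f@_m * \prod_(i < n) value a d b x i ^+ m i = 0.
  pose iota : {rmorphism K -> tower K 4} := @towerC K 4.
  exact: (Eb_eval b12 iota x D Ef).
have tie x row := point_tie (row := row) uS S0 c0 (sum0 x).
have neq_mco (m p : 'X_{1..n}) : m != p -> ~ forall k, (k < n)%N -> mco m k = mco p k.
  by move=> /eqP mp /mco_inj.
have psi0 : {in S, forall m, psideg b (mco m) = 0%N}.
  have [e0 [e1 [e2 low]]] := @lowest_ptA K a d b b12.
  have [|m [p [mS pS mp eqw minw]]] := tie (@ptA (tower K 3) z1 z2 z3 : nat -> tower K 4) (rowsA a b e0 e1 e2).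
    by move=> q _ k kn; right; apply: low.
  have [|psi_m] := posnP (psideg b (mco m)); last first.
    case: (neq_mco _ _ mp); apply: (rowsA_inj b12 (Sstd _ mS) (Sstd _ pS) psi_m _ eqw).
    by rewrite !SD.
  have wphi (q : 'X_{1..n}) : weight b (rowsA a b e0 e1 e2) (mco q) 0%N = phideg b (mco q).
    exact: (rowsA_phideg a e0 e1 e2 (mco q) b12).
  (* [m] has the least Phi-degree, hence at constant total degree the largest Psi-degree, and that
     is zero. *)
  move=> psi_m q qS; have := minw q qS; rewrite !wphi.
  by have := SD _ mS; have := SD _ qS; lia.
have eqphi : {in S &, forall m p, phideg b (mco m) = phideg b (mco p)}.
  by move=> m p mS pS; have := SD _ mS; have := SD _ pS; rewrite !psi0 // !add0n => -> ->.
have phi22 : {in S, forall m, mco m (8 - b)%N = 0%N}.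
  have [|m [p [mS pS mp eqw minw]]] := tie (@ptB (tower K 3) z1 z2 z3 : nat -> tower K 4) (rowsB b).
    move=> q qS k kn; have [kk|kk] := boolP ((k < 4)%N || (8 - b <= k)%N).
      by right; apply: lowest_ptB.
    by left; apply: mco_psi0; rewrite ?psi0 //; lia.
  have [|phi_m] := posnP (mco m (8 - b)%N); last first.
    case: (neq_mco _ _ mp).
    exact: (rowsB_inj b12 (Sstd _ mS) (Sstd _ pS) (psi0 _ mS) (psi0 _ pS) (eqphi _ _ mS pS) phi_m eqw).
  (* [m] lacks Phi(2,2), so its order in ['X], the least one, is not below the common Phi-degree;
     then no order is, and Phi(2,2) occurs nowhere. *)
  move=> phi_m q qS; apply/eqP; rewrite -leqn0 leqNgt.
  rewrite -rowsB_phi22 ?Sstd ?psi0 // -leqNgt (eqphi _ _ qS mS).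
  apply: leq_trans (minw q qS).
  by rewrite leqNgt [(_ < _)%N]rowsB_phi22 ?Sstd ?psi0 // phi_m.
have phi12 : {in S, forall m, mco m (9 - b)%N = 0%N}.
  have [|m [p [mS pS mp eqw minw]]] := tie (@ptC (tower K 3) z1 z2 z3 : nat -> tower K 4) (rowsC b).
    move=> q qS k kn; have [kk|kk] := boolP ((k < 4)%N || (9 - b <= k)%N).
      by right; apply: lowest_ptC.
    left; have [->|k8] := eqVneq k (8 - b)%N; first exact: phi22.
    by apply: mco_psi0; rewrite ?psi0 //; lia.
  have [|phi_m] := posnP (mco m (9 - b)%N); last first.
    case: (neq_mco _ _ mp).
    exact: (rowsC_inj b12 (Sstd _ mS) (Sstd _ pS) (psi0 _ mS) (psi0 _ pS)
      (phi22 _ mS) (phi22 _ pS) (eqphi _ _ mS pS) phi_m eqw).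
  (* [m] has the fewest factors Phi(1,1), hence the most factors Phi(1,2), namely none. *)
  move=> phi_m q qS; have := minw q qS; have := eqphi _ _ mS qS.
  rewrite -(rowsC_phi12 b12 (phi22 _ mS)) -(rowsC_phi12 b12 (phi22 _ qS)) phi_m.
  by lia.
have [|m [p [mS pS mp eqw _]]] := tie (@ptD (tower K 3) z1 z2 z3 : nat -> tower K 4) (rowsD b).
  move=> q qS k kn; have [kk|kk] := boolP ((k < 4)%N || (10 - b <= k)%N).
    by right; apply: lowest_ptD.
  left; have [->|k8] := eqVneq k (8 - b)%N; first exact: phi22.
  have [->|k9] := eqVneq k (9 - b)%N; first exact: phi12.
  by apply: mco_psi0; rewrite ?psi0 //; lia.
apply: (neq_mco _ _ mp).
exact: (rowsD_inj b12 (psi0 _ mS) (psi0 _ pS) (phi22 _ mS) (phi22 _ pS)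
  (phi12 _ mS) (phi12 _ pS) (eqphi _ _ mS pS) eqw).
Qed.
End Independence.

(** * Leading monomials and membership of the generators *)

Section LeadingMonomials.
Variables (K : fieldType) (m0 d a b : nat).
Local Notation n := (nvars b).
Local Notation gt := (@mgtE m0 d a b).
Implicit Types (e : nat -> nat) (F G : {mpoly K[n]}).

Definition mn e : 'X_{1..n} := [multinom e i | i < n].

Lemma mco_mn e k : (k < n)%N -> mco (mn e) k = e k.
Proof. by move=> kn; rewrite /mco mnmE inordK. Qed.

Lemma map_mco_mn e s : all (ltn^~ n) s -> [seq mco (mn e) k | k <- s] = [seq e k | k <- s].
Proof. by move=> /allP sn; apply/eq_in_map => k /sn; apply: mco_mn. Qed.

Lemma omega_mn e : omega m0 d a b (mn e) = (\sum_(0 <= k < n) e k * wvar m0 d a b k)%N.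
Proof. by rewrite big_mkord; apply: eq_bigr => i _; rewrite mnmE. Qed.

Definition is_mon F e : Prop := F = 'X_[mn e].

Lemma is_mon_var k : (k < n)%N -> is_mon (var K b k) (fun i => (i == k)).
Proof.
move=> kn; rewrite /is_mon /var; congr 'X_[_]; apply/mnmP => i; rewrite !mnmE.
by rewrite -val_eqE /= inordK // eq_sym.
Qed.

Lemma is_monM F G e e' : is_mon F e -> is_mon G e' -> is_mon (F * G) (fun i => e i + e' i)%N.
Proof.
by move=> -> ->; rewrite /is_mon -mpolyXD; congr 'X_[_]; apply/mnmP => i; rewrite !(mnmE, mnmDE).
Qed.

Lemma is_monX F e r : is_mon F e -> is_mon (F ^+ r) (fun i => e i * r)%N.
Proof.
by move=> ->; rewrite /is_mon mpolyXn; congr 'X_[_]; apply/mnmP => i; rewrite !(mnmE, mulmnE).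
Qed.

Definition below (m : 'X_{1..n}) F : Prop := forall p, p \in msupp F -> gt m p.

Lemma below0 m : below m 0.
Proof. by move=> p; rewrite msupp0. Qed.

Lemma belowD m F G : below m F -> below m G -> below m (F + G).
Proof. by move=> bF bG p /msuppD_le; rewrite mem_cat => /orP[/bF|/bG]. Qed.

Lemma belowN m F : below m F -> below m (- F).
Proof. by move=> bF p; rewrite (perm_mem (msuppN _)); apply: bF. Qed.

Lemma below_mon m F e : is_mon F e -> gt m (mn e) -> below m F.
Proof. by move=> -> me p /mem_msuppXP <-. Qed.

Lemma lead_mon F e e' : is_mon F e -> (forall k, (k < n)%N -> e k = e' k) ->
  is_lead_mon gt F (mn e').
Proof.
move=> -> ee'; have -> : mn e = mn e' by apply/mnmP => i; rewrite !mnmE ee'.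
by split=> [|p]; rewrite msuppX inE // => /eqP ->; rewrite eqxx.
Qed.

Hypothesis b12 : (b == 1%N) || (b == 2%N).

Lemma leadD F G m : is_lead_mon gt F m -> below m G -> is_lead_mon gt (F + G) m.
Proof.
move=> [mF lead] bG; split.
  have mG : m \notin msupp G by apply/negP => /bG; rewrite mgtE_irr.
  by rewrite mcoeff_msupp mcoeffD (memN_msupp_eq0 mG) addr0 -mcoeff_msupp.
by move=> p /msuppD_le; rewrite mem_cat => /orP[/lead//|/bG].
Qed.

(** The criteria of the order after [omega]. The generators are homogeneous for [omega], so these
    alone compare their terms. *)
Definition lower_psi_phi e e' : bool :=
  let be := [seq e k | k <- iota 4 (4 - b)] in let be' := [seq e' k | k <- iota 4 (4 - b)] in
  let ga := [seq e k | k <- iota (8 - b) 3] in let ga' := [seq e' k | k <- iota (8 - b) 3] in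
  let al := [seq e k | k <- iota 0 4] in let al' := [seq e' k | k <- iota 0 4] in
  [|| (sumn be' < sumn be)%N,
      (sumn be == sumn be') && rightmost_neg be be',
      (be == be') && (sumn ga' < sumn ga)%N,
      (be == be') && (sumn ga == sumn ga') && rightmost_neg ga ga'
    | (be == be') && (ga == ga') && rightmost_neg al al'].

Lemma gt_mn e e' : omega m0 d a b (mn e) = omega m0 d a b (mn e') ->
  lower_psi_phi e e' -> gt (mn e) (mn e').
Proof.
move=> eqw; have sn k r : (k + r <= n)%N -> all (ltn^~ n) (iota k r).
  by move=> kr; apply/allP => j; rewrite mem_iota /= => /andP[_ /leq_trans]; apply.
have bn := b12; rewrite /mgtE /betaE /gammaE /alphaE !map_mco_mn ?eqw ?eqxx;
  try by apply: sn; rewrite /nvars; lia.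
by rewrite ltnn; apply.
Qed.
End LeadingMonomials.

Arguments lead_mon {K m0 d a b F e e'}.

Ltac monomial := repeat first [exact: is_mon_var | apply: is_monM | apply: is_monX].

Lemma omega1_mn (m0 d a : nat) e : omega m0 d a 1 (mn 1 e) =
   (e 0 * (m0 + 1 * d) +
    (e 1 * (m0 + 2 * d) +
    (e 2 * (m0 + 3 * d) +
    (e 3 * (m0 + 0 * d) +
    (e 4 * (a * (m0 + 3 * d) + (m0 + 1 * d)) +
    (e 5 * (a * (m0 + 3 * d) + (m0 + 2 * d)) +
    (e 6 * (a * (m0 + 3 * d) + (m0 + 3 * d)) +
    (e 7 * (m0 + 2 * d + (m0 + 2 * d)) +
    (e 8 * (m0 + 1 * d + (m0 + 2 * d)) +
    (e 9 * (m0 + 1 * d + (m0 + 1 * d)) + 0))))))))))%N.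
Proof. by rewrite omega_mn /index_iota /= !big_cons big_nil. Qed.

Lemma omega2_mn (m0 d a : nat) e : omega m0 d a 2 (mn 2 e) =
   (e 0 * (m0 + 1 * d) +
    (e 1 * (m0 + 2 * d) +
    (e 2 * (m0 + 3 * d) +
    (e 3 * (m0 + 0 * d) +
    (e 4 * (a * (m0 + 3 * d) + (m0 + 2 * d)) +
    (e 5 * (a * (m0 + 3 * d) + (m0 + 3 * d)) +
    (e 6 * (m0 + 2 * d + (m0 + 2 * d)) +
    (e 7 * (m0 + 1 * d + (m0 + 2 * d)) +
    (e 8 * (m0 + 1 * d + (m0 + 1 * d)) + 0)))))))))%N.
Proof. by rewrite omega_mn /index_iota /= !big_cons big_nil. Qed.

(** The weights agree because [m0 = 3a + b] gives a m_3 + m_(b+j) = m_j + (a+d) m_0, the homogeneity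
    of psi(b,j). *)
Ltac smaller := apply: gt_mn => //; rewrite ?omega1_mn ?omega2_mn /=; lia.
Ltac lower := rewrite ?(mulrDr, mulrBr, mulrDl, mulrBl, mulr0);
  repeat first [exact: below0 | apply: belowD | apply: belowN];
  (eapply below_mon; [monomial | smaller]).
(** The leading term must come first after expansion; the others are peeled off from the right. *)
Ltac leading := rewrite ?(mulrDr, mulrBr, mulrDl, mulrBl, mulr0, mulNr, mulrN);
  repeat (apply: leadD => //; [ | lower]); eapply lead_mon; [monomial | by do 10?[case=> //]].

Lemma phib_var (K : fieldType) (a d b k : nat) : (k < nvars b)%N ->
  phib K a d b (var K b k) = phib_img K a d b k.
Proof.
by move=> kn; rewrite /phib /var comp_mpolyXU -tnth_nth tnth_mktuple inordK.
Qed.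

Lemma phibD (K : fieldType) (a d b : nat) : {morph (@phib K a d b) : p q / p + q}.
Proof. by move=> p q; rewrite /phib rmorphD. Qed.
Lemma phibN (K : fieldType) (a d b : nat) : {morph (@phib K a d b) : p / - p}.
Proof. by move=> p; rewrite /phib rmorphN. Qed.
Lemma phibM (K : fieldType) (a d b : nat) : {morph (@phib K a d b) : p q / p * q}.
Proof. by move=> p q; rewrite /phib rmorphM. Qed.
Lemma phibX (K : fieldType) (a d b r : nat) : {morph (@phib K a d b) : p / p ^+ r}.
Proof. by move=> p; rewrite /phib rmorphXn. Qed.
Lemma phib0 (K : fieldType) (a d b : nat) : phib K a d b 0 = 0.
Proof. by rewrite /phib rmorph0. Qed.

(** Membership becomes a ring identity once the powers with symbolic exponents are replaced by fresh
    variables. *)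
Ltac member pv := rewrite /Eb !(phibD, phibN, phibM, phibX, phib0);
  rewrite ?pv //= ?addSn ?addn1 !exprS;
  repeat match goal with |- context [?x ^+ ?n] => is_var n; move: (x ^+ n) => ? end;
  repeat match goal with |- context [?x ^+ (?n + ?m)%N] => is_var n; move: (x ^+ (n + m)%N) => ? end;
  ring.

(** * The generators for b = 1 *)

Section Generators1.
Variables (K : fieldType) (d a' : nat).
Local Notation a := a'.+1.
Local Notation m0 := (3 * a + 1)%N.
Local Notation v := (var K 1).
Local Notation lead s g := (is_lead_mon (@mgtE m0 d a 1) g (mn 1 (nth 0%N s))).
Local Notation x0 := (Xt K 0). Local Notation x1 := (Xt K 1).
Local Notation x2 := (Xt K 2). Local Notation x3 := (Xt K 3).
Local Notation t := (tt_ K).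

Lemma phib_var1 k : (k < 10)%N -> phib K a d 1 (v k) = nth 0 [:: x1;
  x2;
  x3;
  x0;
  (x1 * x3 ^+ a - x0 * x0 ^+ (a + d)) * t;
  (x2 * x3 ^+ a - x1 * x0 ^+ (a + d)) * t;
  (x3 * x3 ^+ a - x2 * x0 ^+ (a + d)) * t;
  (x2 ^+ 2 - x1 * x3) * t;
  (x1 * x2 - x3 * x0) * t;
  (x1 ^+ 2 - x2 * x0) * t] k.
Proof. by move=> kn; rewrite phib_var //; do 10?[case: k kn => [|k] kn //]. Qed.

Lemma gen1_A10 : lead [:: 1; 0; 0; 0; 1] (polA K a d 1 1 0) /\ Eb K a d 1 (polA K a d 1 1 0).
Proof.
(* Conversion evaluates the indices and replaces each out-of-range [Phi] by 0. *)
have -> : polA K a d 1 1 0 = v 0 * v 4 - v 3 * v 5 - v 2 ^+ a * v 9 + v 3 ^+ (a + d) * (0 - 0) by [].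
split; [leading | member phib_var1].
Qed.

Lemma gen1_A11 : lead [:: 1; 0; 0; 0; 0; 1] (polA K a d 1 1 1) /\ Eb K a d 1 (polA K a d 1 1 1).
Proof.
have -> : polA K a d 1 1 1 = v 0 * v 5 - v 3 * v 6 - v 2 ^+ a * v 8 + v 3 ^+ (a + d) * (v 9 - 0) by [].
split; [leading | member phib_var1].
Qed.

Lemma gen1_A20 : lead [:: 0; 1; 0; 0; 1] (polA K a d 1 2 0) /\ Eb K a d 1 (polA K a d 1 2 0).
Proof.
have -> : polA K a d 1 2 0 = v 1 * v 4 - v 3 * v 6 - v 2 ^+ a * v 8 + v 3 ^+ (a + d) * (0 - 0) by [].
split; [leading | member phib_var1].
Qed.

Lemma gen1_A21 : lead [:: 0; 1; 0; 0; 0; 1] (polA K a d 1 2 1) /\ Eb K a d 1 (polA K a d 1 2 1).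
Proof.
have -> : polA K a d 1 2 1 = v 1 * v 5 - v 0 * v 6 - v 2 ^+ a * v 7 + v 3 ^+ (a + d) * (v 8 - v 8) by [].
split; [leading | member phib_var1].
Qed.

Lemma gen1_A30 : lead [:: 0; 0; 1; 0; 1] (polA K a d 1 3 0) /\ Eb K a d 1 (polA K a d 1 3 0).
Proof.
have -> : polA K a d 1 3 0 = v 2 * v 4 - v 0 * v 6 - v 2 ^+ a * 0 + v 3 ^+ (a + d) * (0 - v 8) by [].
split; [leading | member phib_var1].
Qed.

Lemma gen1_A31 : lead [:: 0; 0; 1; 0; 0; 1] (polA K a d 1 3 1) /\ Eb K a d 1 (polA K a d 1 3 1).
Proof.
have -> : polA K a d 1 3 1 = v 2 * v 5 - v 1 * v 6 - v 2 ^+ a * 0 + v 3 ^+ (a + d) * (0 - v 7) by [].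
split; [leading | member phib_var1].
Qed.

Lemma gen1_B11 : lead [:: 2; 0; 0; 0; 0; 0; 1] (polB K a d 1 1 1) /\ Eb K a d 1 (polB K a d 1 1 1).
Proof.
have -> : polB K a d 1 1 1 = (v 0 ^+ 2 - v 1 * v 3) * v 6 - (v 2 ^+ (a + 1) - v 1 * v 3 ^+ (a + d)) * v 9 by [].
split; [leading | member phib_var1].
Qed.

Lemma gen1_B12 : lead [:: 1; 1; 0; 0; 0; 0; 1] (polB K a d 1 1 2) /\ Eb K a d 1 (polB K a d 1 1 2).
Proof.
have -> : polB K a d 1 1 2 = (v 0 * v 1 - v 2 * v 3) * v 6 - (v 2 ^+ (a + 1) - v 1 * v 3 ^+ (a + d)) * v 8 by [].
split; [leading | member phib_var1].
Qed.

Lemma gen1_B21 : lead [:: 1; 1; 0; 0; 0; 0; 1] (polB K a d 1 2 1) /\ Eb K a d 1 (polB K a d 1 2 1).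
Proof.
have -> : polB K a d 1 2 1 = (v 0 * v 1 - v 2 * v 3) * v 6 - (v 2 ^+ (a + 1) - v 1 * v 3 ^+ (a + d)) * v 8 by [].
split; [leading | member phib_var1].
Qed.

Lemma gen1_B22 : lead [:: 0; 2; 0; 0; 0; 0; 1] (polB K a d 1 2 2) /\ Eb K a d 1 (polB K a d 1 2 2).
Proof.
have -> : polB K a d 1 2 2 = (v 1 ^+ 2 - v 0 * v 2) * v 6 - (v 2 ^+ (a + 1) - v 1 * v 3 ^+ (a + d)) * v 7 by [].
split; [leading | member phib_var1].
Qed.

Lemma gen1_D : lead [:: 2; 0; 0; 0; 0; 0; 0; 0; 1] (polD K 1) /\ Eb K a d 1 (polD K 1).
Proof.
have -> : polD K 1 = (v 0 ^+ 2 - v 1 * v 3) * v 8 - (v 0 * v 1 - v 2 * v 3) * v 9 by [].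
split; [leading | member phib_var1].
Qed.

Lemma gen1_L0 : lead [:: 0; 0; 0; 1; 0; 0; 0; 1] (polL K 1 0) /\ Eb K a d 1 (polL K 1 0).
Proof.
have -> : polL K 1 0 = v 3 * v 7 - v 0 * v 8 + v 1 * v 9 by [].
split; [leading | member phib_var1].
Qed.

Lemma gen1_L1 : lead [:: 1; 0; 0; 0; 0; 0; 0; 1] (polL K 1 1) /\ Eb K a d 1 (polL K 1 1).
Proof.
have -> : polL K 1 1 = v 0 * v 7 - v 1 * v 8 + v 2 * v 9 by [].
split; [leading | member phib_var1].
Qed.

Lemma gen1_Q11 : lead [:: 0; 0; 0; 0; 1; 0; 0; 1] (polQ11 K 1) /\ Eb K a d 1 (polQ11 K 1).
Proof.
have -> : polQ11 K 1 = v 4 * v 7 + v 6 * v 9 - v 5 * v 8 by [].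
split; [leading | member phib_var1].
Qed.

Lemma gen1_Q12 : lead [:: 0; 0; 0; 0; 0; 2] (polQ12 K a d 1) /\ Eb K a d 1 (polQ12 K a d 1).
Proof.
have -> : polQ12 K a d 1 = v 5 ^+ 2 - v 6 * v 4 - v 2 ^+ (a - 1) * v 6 * v 7 + v 3 ^+ (a + d - 1) * v 4 * v 9 - v 2 ^+ (a - 1) * v 3 ^+ (a + d - 1) * (v 8 ^+ 2 - v 7 * v 9) by [].
(* With [a = a'.+1] the natural subtractions become [a'] and [a' + d]. *)
rewrite subn1 (_ : a + d - 1 = a' + d)%N /=; last by lia.
split; [leading | member phib_var1].
Qed.

End Generators1.

(** * The generators for b = 2 *)

Section Generators2.
Variables (K : fieldType) (d a' : nat).
Local Notation a := a'.+1.
Local Notation m0 := (3 * a + 2)%N.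
Local Notation v := (var K 2).
Local Notation lead s g := (is_lead_mon (@mgtE m0 d a 2) g (mn 2 (nth 0%N s))).
Local Notation x0 := (Xt K 0). Local Notation x1 := (Xt K 1).
Local Notation x2 := (Xt K 2). Local Notation x3 := (Xt K 3).
Local Notation t := (tt_ K).

Lemma phib_var2 k : (k < 9)%N -> phib K a d 2 (v k) = nth 0 [:: x1;
  x2;
  x3;
  x0;
  (x2 * x3 ^+ a - x0 * x0 ^+ (a + d)) * t;
  (x3 * x3 ^+ a - x1 * x0 ^+ (a + d)) * t;
  (x2 ^+ 2 - x1 * x3) * t;
  (x1 * x2 - x3 * x0) * t;
  (x1 ^+ 2 - x2 * x0) * t] k.
Proof. by move=> kn; rewrite phib_var //; do 9?[case: k kn => [|k] kn //]. Qed.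

Lemma gen2_A10 : lead [:: 1; 0; 0; 0; 1] (polA K a d 2 1 0) /\ Eb K a d 2 (polA K a d 2 1 0).
Proof.
have -> : polA K a d 2 1 0 = v 0 * v 4 - v 3 * v 5 - v 2 ^+ a * v 7 + v 3 ^+ (a + d) * (0 - 0) by [].
split; [leading | member phib_var2].
Qed.

Lemma gen2_A20 : lead [:: 0; 1; 0; 0; 1] (polA K a d 2 2 0) /\ Eb K a d 2 (polA K a d 2 2 0).
Proof.
have -> : polA K a d 2 2 0 = v 1 * v 4 - v 0 * v 5 - v 2 ^+ a * v 6 + v 3 ^+ (a + d) * (0 - v 8) by [].
split; [leading | member phib_var2].
Qed.

Lemma gen2_A30 : lead [:: 0; 0; 1; 0; 1] (polA K a d 2 3 0) /\ Eb K a d 2 (polA K a d 2 3 0).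
Proof.
have -> : polA K a d 2 3 0 = v 2 * v 4 - v 1 * v 5 - v 2 ^+ a * 0 + v 3 ^+ (a + d) * (0 - v 7) by [].
split; [leading | member phib_var2].
Qed.

Lemma gen2_B11 : lead [:: 2; 0; 0; 0; 0; 1] (polB K a d 2 1 1) /\ Eb K a d 2 (polB K a d 2 1 1).
Proof.
have -> : polB K a d 2 1 1 = (v 0 ^+ 2 - v 1 * v 3) * v 5 - (v 2 ^+ (a + 1) - v 0 * v 3 ^+ (a + d)) * v 8 by [].
split; [leading | member phib_var2].
Qed.

Lemma gen2_B12 : lead [:: 1; 1; 0; 0; 0; 1] (polB K a d 2 1 2) /\ Eb K a d 2 (polB K a d 2 1 2).
Proof.
have -> : polB K a d 2 1 2 = (v 0 * v 1 - v 2 * v 3) * v 5 - (v 2 ^+ (a + 1) - v 0 * v 3 ^+ (a + d)) * v 7 by [].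
split; [leading | member phib_var2].
Qed.

Lemma gen2_B21 : lead [:: 1; 1; 0; 0; 0; 1] (polB K a d 2 2 1) /\ Eb K a d 2 (polB K a d 2 2 1).
Proof.
have -> : polB K a d 2 2 1 = (v 0 * v 1 - v 2 * v 3) * v 5 - (v 2 ^+ (a + 1) - v 0 * v 3 ^+ (a + d)) * v 7 by [].
split; [leading | member phib_var2].
Qed.

Lemma gen2_B22 : lead [:: 0; 2; 0; 0; 0; 1] (polB K a d 2 2 2) /\ Eb K a d 2 (polB K a d 2 2 2).
Proof.
have -> : polB K a d 2 2 2 = (v 1 ^+ 2 - v 0 * v 2) * v 5 - (v 2 ^+ (a + 1) - v 0 * v 3 ^+ (a + d)) * v 6 by [].
split; [leading | member phib_var2].
Qed.

Lemma gen2_D : lead [:: 2; 0; 0; 0; 0; 0; 0; 1] (polD K 2) /\ Eb K a d 2 (polD K 2).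
Proof.
have -> : polD K 2 = (v 0 ^+ 2 - v 1 * v 3) * v 7 - (v 0 * v 1 - v 2 * v 3) * v 8 by [].
split; [leading | member phib_var2].
Qed.

Lemma gen2_L0 : lead [:: 0; 0; 0; 1; 0; 0; 1] (polL K 2 0) /\ Eb K a d 2 (polL K 2 0).
Proof.
have -> : polL K 2 0 = v 3 * v 6 - v 0 * v 7 + v 1 * v 8 by [].
split; [leading | member phib_var2].
Qed.

Lemma gen2_L1 : lead [:: 1; 0; 0; 0; 0; 0; 1] (polL K 2 1) /\ Eb K a d 2 (polL K 2 1).
Proof.
have -> : polL K 2 1 = v 0 * v 6 - v 1 * v 7 + v 2 * v 8 by [].
split; [leading | member phib_var2].
Qed.

Lemma gen2_Q21 : lead [:: 0; 0; 0; 0; 2; 0; 1] (polQ21 K a d 2) /\ Eb K a d 2 (polQ21 K a d 2).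
Proof.
have -> : polQ21 K a d 2 = v 4 ^+ 2 * v 6 - v 2 ^+ (a - 1) * v 5 * v 6 ^+ 2 - v 5 * v 4 * v 7 - v 2 ^+ (a - 1) * v 3 ^+ (a + d - 1) * v 7 ^+ 3 + v 5 ^+ 2 * v 8 + v 2 ^+ (a - 1) * v 3 ^+ (a + d - 1) * v 6 * v 7 * v 8 + v 3 ^+ (a + d - 1) * v 4 * v 8 ^+ 2 by [].
rewrite subn1 (_ : a + d - 1 = a' + d)%N /=; last by lia.
split; [leading | member phib_var2].
Qed.

End Generators2.

(** * From leading monomials and independence to the Groebner basis *)

Lemma std_standard (b : nat) (m : 'X_{1..nvars b}) :
  standard [seq mn b (nth 0%N s) | s <- leads b] m = std b (mco m).
Proof.
rewrite /standard has_map /std -all_predC; apply: eq_all => s; congr (~~ _).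
apply/forallP/allP => [h k|h i].
  rewrite mem_iota add0n => /andP[_ kn].
  by have := h (Ordinal kn); rewrite mnmE /mco /= (_ : inord k = Ordinal kn) //; apply: val_inj; rewrite /= inordK.
by have := h i; rewrite mnmE mem_iota ltn_ord /mco inord_val; apply.
Qed.

Lemma lead_at (K : fieldType) (n : nat) (gt : rel 'X_{1..n}) (G : seq {mpoly K[n]})
    (m : 'X_{1..n}) (k : nat) :
  (k < size G)%N -> is_lead_mon gt (nth 0 G k) m ->
  exists2 g, g \in G & is_lead_mon gt g m.
Proof. by move=> kG lead; exists (nth 0 G k); first exact: mem_nth. Qed.

Lemma groebner_of_leads (K : fieldType) (m0 d a b : nat) (G : seq {mpoly K[nvars b]}) :
  (b == 1%N) || (b == 2%N) -> (0 < m0)%N ->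
  (forall g, g \in G -> Eb K a d b g) ->
  (forall s, s \in leads b ->
     exists2 g, g \in G & is_lead_mon (@mgtE m0 d a b) g (mn b (nth 0%N s))) ->
  groebner_basis (@mgtE m0 d a b) (Eb K a d b) G.
Proof.
move=> b12 m0_gt0 GE Glead.
have lmsG e : e \in [seq mn b (nth 0%N s) | s <- leads b] ->
    exists2 g, g \in G & is_lead_mon (@mgtE m0 d a b) g e.
  by move=> /mapP[s /Glead ? ->].
apply: (@groebner_of_independent _ _ _ _ _ _ _ _ _ _ _ _ [seq mn b (nth 0%N s) | s <- leads b]) => //.
- exact: mgtE_irr.
- exact: mgtE_trans.
- exact: mgtE_total.
- exact: mgtED.
- exact: mgtE_ind.
- exact: phib0.
- by move=> f g Ef Eg; rewrite /Eb phibD Ef Eg addr0.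
- by move=> f g Eg; rewrite /Eb phibM Eg mulr0.
- by move=> e /lmsG[g /GE Eg lead]; exists g.
move=> f Ef fstd; apply: (standard_independent b12 Ef) => m mf.
by rewrite -std_standard; apply: fstd.
Qed.

Lemma groebner1 (K : fieldType) (d a : nat) : (1 <= a)%N ->
  groebner_basis (@mgtE (3 * a + 1) d a 1) (Eb K a d 1) (GBb K a d 1).
Proof.
case: a => // a' _; apply: groebner_of_leads => [//||g|s]; first by lia.
  rewrite !inE; do ?[case/orP]; move/eqP->;
    [
     exact: (gen1_A10 K d a').2|
     exact: (gen1_A11 K d a').2|
     exact: (gen1_A20 K d a').2|
     exact: (gen1_A21 K d a').2|
     exact: (gen1_A30 K d a').2|
     exact: (gen1_A31 K d a').2|
     exact: (gen1_B11 K d a').2|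
     exact: (gen1_B12 K d a').2|
     exact: (gen1_B21 K d a').2|
     exact: (gen1_B22 K d a').2|
     exact: (gen1_D K d a').2|
     exact: (gen1_L0 K d a').2|
     exact: (gen1_L1 K d a').2|
     exact: (gen1_Q11 K d a').2|
     exact: (gen1_Q12 K d a').2].
(* The numbers are positions in [GBb], taken in the order of [leads]. Position 8 is absent because
   B(2,1) has the leading monomial of B(1,2). *)
rewrite !inE; do ?[case/orP]; move/eqP->;
  [
   exact: (@lead_at _ _ _ (GBb K a'.+1 d 1) _ 0 isT (gen1_A10 K d a').1)|
   exact: (@lead_at _ _ _ (GBb K a'.+1 d 1) _ 2 isT (gen1_A20 K d a').1)|
   exact: (@lead_at _ _ _ (GBb K a'.+1 d 1) _ 4 isT (gen1_A30 K d a').1)|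
   exact: (@lead_at _ _ _ (GBb K a'.+1 d 1) _ 1 isT (gen1_A11 K d a').1)|
   exact: (@lead_at _ _ _ (GBb K a'.+1 d 1) _ 3 isT (gen1_A21 K d a').1)|
   exact: (@lead_at _ _ _ (GBb K a'.+1 d 1) _ 5 isT (gen1_A31 K d a').1)|
   exact: (@lead_at _ _ _ (GBb K a'.+1 d 1) _ 6 isT (gen1_B11 K d a').1)|
   exact: (@lead_at _ _ _ (GBb K a'.+1 d 1) _ 7 isT (gen1_B12 K d a').1)|
   exact: (@lead_at _ _ _ (GBb K a'.+1 d 1) _ 9 isT (gen1_B22 K d a').1)|
   exact: (@lead_at _ _ _ (GBb K a'.+1 d 1) _ 10 isT (gen1_D K d a').1)|
   exact: (@lead_at _ _ _ (GBb K a'.+1 d 1) _ 11 isT (gen1_L0 K d a').1)|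
   exact: (@lead_at _ _ _ (GBb K a'.+1 d 1) _ 12 isT (gen1_L1 K d a').1)|
   exact: (@lead_at _ _ _ (GBb K a'.+1 d 1) _ 13 isT (gen1_Q11 K d a').1)|
   exact: (@lead_at _ _ _ (GBb K a'.+1 d 1) _ 14 isT (gen1_Q12 K d a').1)].
Qed.

Lemma groebner2 (K : fieldType) (d a : nat) : (1 <= a)%N ->
  groebner_basis (@mgtE (3 * a + 2) d a 2) (Eb K a d 2) (GBb K a d 2).
Proof.
case: a => // a' _; apply: groebner_of_leads => [//||g|s]; first by lia.
  rewrite !inE; do ?[case/orP]; move/eqP->;
    [
     exact: (gen2_A10 K d a').2|
     exact: (gen2_A20 K d a').2|
     exact: (gen2_A30 K d a').2|
     exact: (gen2_B11 K d a').2|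
     exact: (gen2_B12 K d a').2|
     exact: (gen2_B21 K d a').2|
     exact: (gen2_B22 K d a').2|
     exact: (gen2_D K d a').2|
     exact: (gen2_L0 K d a').2|
     exact: (gen2_L1 K d a').2|
     exact: (gen2_Q21 K d a').2].
(* As before, with B(2,1) now at the absent position 5. *)
rewrite !inE; do ?[case/orP]; move/eqP->;
  [
   exact: (@lead_at _ _ _ (GBb K a'.+1 d 2) _ 0 isT (gen2_A10 K d a').1)|
   exact: (@lead_at _ _ _ (GBb K a'.+1 d 2) _ 1 isT (gen2_A20 K d a').1)|
   exact: (@lead_at _ _ _ (GBb K a'.+1 d 2) _ 2 isT (gen2_A30 K d a').1)|
   exact: (@lead_at _ _ _ (GBb K a'.+1 d 2) _ 3 isT (gen2_B11 K d a').1)|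
   exact: (@lead_at _ _ _ (GBb K a'.+1 d 2) _ 4 isT (gen2_B12 K d a').1)|
   exact: (@lead_at _ _ _ (GBb K a'.+1 d 2) _ 6 isT (gen2_B22 K d a').1)|
   exact: (@lead_at _ _ _ (GBb K a'.+1 d 2) _ 7 isT (gen2_D K d a').1)|
   exact: (@lead_at _ _ _ (GBb K a'.+1 d 2) _ 8 isT (gen2_L0 K d a').1)|
   exact: (@lead_at _ _ _ (GBb K a'.+1 d 2) _ 9 isT (gen2_L1 K d a').1)|
   exact: (@lead_at _ _ _ (GBb K a'.+1 d 2) _ 10 isT (gen2_Q21 K d a').1)].
Qed.

Theorem theorem5p5 (K : fieldType) (m0 d a b : nat) :
  (0 < d)%N ->
  gcdn (gcdn (mi m0 d 0) (mi m0 d 1)) (gcdn (mi m0 d 2) (mi m0 d 3)) = 1%N ->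
  minimally_generating (fun i : 'I_4 => mi m0 d i) ->
  (1 <= a)%N -> (b == 1%N) || (b == 2%N) -> m0 = (3 * a + b)%N ->
  groebner_basis (mgtE m0 d a b) (Eb K a d b) (GBb K a d b).
Proof.
by move=> _ _ _ a1 /orP[] /eqP -> ->; [apply: groebner1 | apply: groebner2].
Qed.
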